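(* For a given value $\mu\in\mathbb{R}$ of the momentum map, the Routhian of the 3D pendulum is $$R^{\mu}(\Gamma,\dot\Gamma)=\tfrac12(\dot\Gamma\times\Gamma)\cdot J(\dot\Gamma\times\Gamma)-\tfrac12(b^2+\nu^2)(\Gamma\cdot J\Gamma)+mg\,\Gamma\cdot\rho,\qquad (\Gamma,\dot\Gamma)\in TS^2,$$ where $b=\frac{J\Gamma\cdot(\dot\Gamma\times\Gamma)}{\Gamma\cdot J\Gamma}$ and $\nu=\frac{\mu}{\Gamma\cdot J\Gamma}$, and the magnetic two-form can be written, for $\eta,\zeta\in\mathbb{R}^3$, as $$\beta_\mu(\Gamma\times\eta,\Gamma\times\zeta)=-\frac{\mu}{(\Gamma\cdot J\Gamma)^2}\left[-(\Gamma\cdot J\Gamma)\,\mathrm{tr}[J]+2\|J\Gamma\|^2\right]\Gamma\cdot(\eta\times\zeta).$$ The Routhian satisfies the Euler--Lagrange equation with the magnetic term $$\delta\int_0^T R^\mu(\Gamma,\dot\Gamma)\,dt=\int_0^T\mathbf{i}_{\dot\Gamma}\beta_\mu(\delta\Gamma)\,dt.$$ This yields the reduced equation of motion on $TS^2$: $$\ddot\Gamma=-\|\dot\Gamma\|^2\Gamma+\Gamma\times\Sigma,$$ where $$\Sigma=b\dot\Gamma+J^{-1}\Big[\big(J(\dot\Gamma\times\Gamma)-bJ\Gamma\big)\times\big((\dot\Gamma\times\Gamma)-b\Gamma\big)+\nu^2J\Gamma\times\Gamma-mg\,\Gamma\times\rho-c\,\dot\Gamma\Big],$$ $$c=\nu\left\{\mathrm{tr}[J]-2\frac{\|J\Gamma\|^2}{\Gamma\cdot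 J\Gamma}\right\}.$$
   Context: The 3D pendulum is the Lagrangian system on $SO(3)$ with Lagrangian $L(R,\omega)=\frac12\omega^TJ\omega+mg\,\rho^TR^Te_3$, where $\dot R=R\widehat\omega$, i.e. with equations $J\dot\omega=J\omega\times\omega+mg\rho\times R^Te_3$. Here $J$ is the symmetric positive definite inertia matrix in the body frame with origin at the pivot, $m,g>0$, $\rho\in\mathbb{R}^3$, $\rho\ne0$, is the body-fixed vector from the pivot to the center of mass, $e_3=(0,0,1)^T$, and $\widehat a\,b=a\times b$. $TSO(3)$ is identified with $SO(3)\times\mathbb{R}^3$ via $(R,R\widehat\omega)\leftrightarrow(R,\omega)$. $L$ is invariant under the $S^1$ action $\Phi_\theta(R)=\exp(\theta\widehat e_3)R$; the quotient is $SO(3)/S^1\cong S^2$ with projection $\Pi(R)=R^Te_3=\Gamma$, so $\dot\Gamma=\Gamma\times\omega$. Identifying the Lie algebra of $S^1$ with $\mathbb{R}$, the momentum map is $\mathbf{J}(R,\widehat\omega)=e_3^TRJ\omega$, and the mechanical connection is $\mathcal{A}(R,\widehat\omega)=\frac{e_3^TRJ\omega}{e_3^TRJR^Te_3}$. For given $\mu$ let $\mathcal{A}_\mu=\langle\mu,\mathcal{A}\rangle=\mu\mathcal{A}$, a 1-form on $SO(3)$. The Routhian is $L-\mathcal{A}_\mu$ restricted to the level set $\mathbf{J}=\mu$, which induces a function $R^\mu$ on $TS^2$; the magnetic two-form $\beta_\mu$ on $S^2$ is induced by the exterior derivative: $\Pi^*\beta_\mu=\mathbf{d}\mathcal{A}_\mu$.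 In the variational equation, $\delta$ denotes variations of the curve $\Gamma(t)\in S^2$, $t\in[0,T]$, with fixed endpoints, $\Gamma(t)$ is the projection of a motion of the pendulum with momentum value $\mu$, and $\mathbf{i}$ denotes interior product. *)

(* Defs.v *)
From HB Require Import structures.
From mathcomp Require Import all_boot all_order all_algebra.
From mathcomp Require Import all_classical all_reals all_analysis.
From mathcomp Require Import ring.

Set Implicit Arguments.
Unset Strict Implicit.
Unset Printing Implicit Defensive.

Import Order.TTheory GRing.Theory Num.Theory.
Import numFieldNormedType.Exports.

Local Open Scope classical_set_scope.
Local Open Scope ring_scope.

Definition vec3 (R : realType) (x y z : R) : 'cV[R]_3 :=
  \col_(i < 3) [:: x; y; z]`_i.

Definition e3 (R : realType) : 'cV[R]_3 := vec3 0 0 1.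

Definition dot (R : realType) (u v : 'cV[R]_3) : R := \sum_i u i 0 * v i 0.

Definition cross (R : realType) (u v : 'cV[R]_3) : 'cV[R]_3 :=
  vec3 (u 1 0 * v 2 0 - u 2 0 * v 1 0)
       (u 2 0 * v 0 0 - u 0 0 * v 2 0)
       (u 0 0 * v 1 0 - u 1 0 * v 0 0).

Notation "u *d v" := (dot u v) (at level 40).
Notation "u *v v" := (cross u v) (at level 40).

(* The norm [`|u|] of the library on matrices is the sup norm. *)
Definition enorm (R : realType) (u : 'cV[R]_3) : R := Num.sqrt (u *d u).

Definition hat (R : realType) (a : 'cV[R]_3) : 'M[R]_3 :=
  \matrix_(i, j) (a *v delta_mx j 0) i 0.

Lemma hatE (R : realType) (a b : 'cV[R]_3) : hat a *m b = a *v b.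
Proof.
have b1 : b (lift 0 0) 0 = b 1 0 by congr (b _ _); apply/val_inj.
have b2 : b (lift 0 (lift 0 0)) 0 = b 2 0 by congr (b _ _); apply/val_inj.
apply/matrixP => i j; rewrite (ord1 j) mxE !big_ord_recl big_ord0 b1 b2.
case: i => [[|[|[|//]]] ?]; rewrite !mxE /=; ring.
Qed.

Definition SO3 (R : realType) (Q : 'M[R]_3) : Prop :=
  Q^T *m Q = 1%:M /\ \det Q = 1.

Definition sphere2 (R : realType) (G : 'cV[R]_3) : Prop := G *d G = 1.

Definition tangent_sphere2 (R : realType) (G V : 'cV[R]_3) : Prop :=
  sphere2 G /\ G *d V = 0.

Definition inertia_matrix (R : realType) (J : 'M[R]_3) : Prop :=
  J^T = J /\ forall x : 'cV[R]_3, x != 0 -> 0 < x *d (J *m x).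

(* A tangent vector of SO(3) at Q is written Q *m hat w with w in R^3, so that
   functions on TSO(3) and 1-forms on SO(3) are functions of (Q, w). *)

Definition lagrangian (R : realType) (J : 'M[R]_3) (m g : R) (rho : 'cV[R]_3)
    (Q : 'M[R]_3) (w : 'cV[R]_3) : R :=
  2^-1 * (w *d (J *m w)) + m * g * (rho *d (Q^T *m e3 R)).

Definition momentum (R : realType) (J : 'M[R]_3)
    (Q : 'M[R]_3) (w : 'cV[R]_3) : R :=
  e3 R *d (Q *m J *m w).

Definition mech_connection (R : realType) (J : 'M[R]_3)
    (Q : 'M[R]_3) (w : 'cV[R]_3) : R :=
  momentum J Q w / (e3 R *d (Q *m J *m Q^T *m e3 R)).

Definition mech_connection_at (R : realType) (J : 'M[R]_3) (mu : R)
    (Q : 'M[R]_3) (w : 'cV[R]_3) : R :=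
  mu * mech_connection J Q w.

Definition Pi (R : realType) (Q : 'M[R]_3) : 'cV[R]_3 := Q^T *m e3 R.

(* The derivative of [Pi] along Q *m hat w; recall that [Pi] is linear in
   the entries of Q. It equals Pi Q *v w. *)
Definition dPi (R : realType) (Q : 'M[R]_3) (w : 'cV[R]_3) : 'cV[R]_3 :=
  Pi (Q *m hat w).

(* l is the derivative at Q, along the tangent vector Q *m hat eta, of the
   function f on SO(3); only the values of f on SO(3) matter. Such curves C
   exist for all Q and eta, hence l is unique. *)
Definition is_derivative_along (R : realType) (f : 'M[R]_3 -> R)
    (Q : 'M[R]_3) (eta : 'cV[R]_3) (l : R) : Prop :=
  forall C : R -> 'M[R]_3,
    (forall s, SO3 (C s)) -> C 0 = Q ->
    is_derive (0 : R) (1 : R) C (Q *m hat eta) ->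
    is_derive (0 : R) (1 : R) (f \o C) l.

(* B = d alpha on SO(3): d alpha(X, Y) = X[alpha(Y)] - Y[alpha(X)]
   - alpha([X, Y]) evaluated on the left-invariant fields X(Q) = Q *m hat eta
   and Y(Q) = Q *m hat zeta, whose Jacobi-Lie bracket is the field
   Q *m hat (eta *v zeta). *)
Definition is_exterior_derivative (R : realType)
    (alpha : 'M[R]_3 -> 'cV[R]_3 -> R)
    (B : 'M[R]_3 -> 'cV[R]_3 -> 'cV[R]_3 -> R) : Prop :=
  forall (Q : 'M[R]_3) (eta zeta : 'cV[R]_3), SO3 Q ->
    exists x y : R,
      [/\ is_derivative_along (fun P => alpha P zeta) Q eta x,
          is_derivative_along (fun P => alpha P eta) Q zeta y &
          B Q eta zeta = x - y - alpha Q (eta *v zeta)].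

(* Rmu G V is the value at (G, V) in TS^2; other values are irrelevant. *)
Definition is_routhian (R : realType) (J : 'M[R]_3) (m g : R)
    (rho : 'cV[R]_3) (mu : R) (Rmu : 'cV[R]_3 -> 'cV[R]_3 -> R) : Prop :=
  forall (Q : 'M[R]_3) (w : 'cV[R]_3), SO3 Q -> momentum J Q w = mu ->
    Rmu (Pi Q) (dPi Q w) =
    lagrangian J m g rho Q w - mech_connection_at J mu Q w.

(* beta G X Y is the value at G of the form on S^2 on X, Y tangent at G. *)
Definition is_magnetic_form (R : realType) (J : 'M[R]_3) (mu : R)
    (beta : 'cV[R]_3 -> 'cV[R]_3 -> 'cV[R]_3 -> R) : Prop :=
  is_exterior_derivative (mech_connection_at J mu)
    (fun Q eta zeta => beta (Pi Q) (dPi Q eta) (dPi Q zeta)).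

Definition coef_b (R : realType) (J : 'M[R]_3) (G V : 'cV[R]_3) : R :=
  ((J *m G) *d (V *v G)) / (G *d (J *m G)).

Definition coef_nu (R : realType) (J : 'M[R]_3) (mu : R) (G : 'cV[R]_3) : R :=
  mu / (G *d (J *m G)).

Definition coef_c (R : realType) (J : 'M[R]_3) (mu : R) (G : 'cV[R]_3) : R :=
  coef_nu J mu G * (\tr J - 2 * (enorm (J *m G) ^+ 2 / (G *d (J *m G)))).

Definition Sigma (R : realType) (J : 'M[R]_3) (m g : R) (rho : 'cV[R]_3)
    (mu : R) (G V : 'cV[R]_3) : 'cV[R]_3 :=
  let b := coef_b J G V in
  let nu := coef_nu J mu G in
  let c := coef_c J mu G in
  b *: V +
  invmx J *m (((J *m (V *v G) - b *: (J *m G)) *v (V *v G - b *: G))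
              + nu ^+ 2 *: ((J *m G) *v G) - (m * g) *: (G *v rho) - c *: V).

(* A motion of the pendulum on the open time interval ]t0, t1[. *)
Definition pendulum_motion (R : realType) (J : 'M[R]_3) (m g : R)
    (rho : 'cV[R]_3) (t0 t1 : R) (Q : R -> 'M[R]_3) (w : R -> 'cV[R]_3) :
    Prop :=
  forall t : R, t0 < t < t1 ->
    [/\ SO3 (Q t),
        is_derive t (1 : R) Q (Q t *m hat (w t)),
        derivable w t (1 : R) &
        J *m (derive1 w t) =
        (J *m w t) *v w t + (m * g) *: (rho *v ((Q t)^T *m e3 R))].

Definition C2_sphere_curve (R : realType) (t0 t1 : R) (G : R -> 'cV[R]_3) :
    Prop :=
  forall t : R, t0 < t < t1 ->
    [/\ sphere2 (G t), derivable G t (1 : R), derivable (derive1 G) t (1 : R) &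
        {for t, continuous (derive1n 2 G)}].

(* C^1 and C^2 functions on an open set U of R x R, by partial derivatives. *)
Definition C1_on (R : realType) (U : set (R * R)) (f : R * R -> 'cV[R]_3) :
    Prop :=
  forall p : R * R, U p ->
    [/\ derivable f p ((1, 0) : R * R), derivable f p ((0, 1) : R * R),
        {for p, continuous ('D_((1, 0) : R * R) f)} &
        {for p, continuous ('D_((0, 1) : R * R) f)}].

Definition C2_on (R : realType) (U : set (R * R)) (f : R * R -> 'cV[R]_3) :
    Prop :=
  [/\ C1_on U f, C1_on U ('D_((1, 0) : R * R) f) &
      C1_on U ('D_((0, 1) : R * R) f)].

(* F (e, t) is a C^2 family of curves on S^2, |e| < d, through the curve G at
   e = 0, and with the endpoints at times 0 and T fixed. *)
Definition variation (R : realType) (t0 t1 T d : R) (G : R -> 'cV[R]_3)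
    (F : R * R -> 'cV[R]_3) : Prop :=
  [/\ C2_on [set p : R * R | - d < p.1 < d /\ t0 < p.2 < t1] F,
      forall e t : R, - d < e < d -> t0 < t < t1 -> sphere2 (F (e, t)),
      forall t : R, t0 < t < t1 -> F (0, t) = G t &
      forall e : R, - d < e < d -> F (e, 0) = G 0 /\ F (e, T) = G T].

(* delta int_0^T Rmu(G, G') dt = int_0^T beta(G', delta G) dt, where delta is
   the derivative at e = 0 along any variation F of G. *)
Definition magnetic_euler_lagrange (R : realType)
    (Rmu : 'cV[R]_3 -> 'cV[R]_3 -> R)
    (beta : 'cV[R]_3 -> 'cV[R]_3 -> 'cV[R]_3 -> R)
    (t0 t1 T : R) (G : R -> 'cV[R]_3) : Prop :=
  forall (d : R) (F : R * R -> 'cV[R]_3),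
    0 < d -> variation t0 t1 T d G F ->
    is_derive (0 : R) (1 : R)
      (fun e : R => \int[lebesgue_measure]_(t in `[0, T])
         Rmu (F (e, t)) ('D_((0, 1) : R * R) F (e, t)))
      (\int[lebesgue_measure]_(t in `[0, T])
         beta (G t) (derive1 G t) ('D_((1, 0) : R * R) F (0, t))).

Definition reduced_equation (R : realType) (J : 'M[R]_3) (m g : R)
    (rho : 'cV[R]_3) (mu T : R) (G : R -> 'cV[R]_3) : Prop :=
  forall t : R, 0 <= t <= T ->
    derive1n 2 G t = - (enorm (derive1 G t) ^+ 2) *: G t
               + G t *v Sigma J m g rho mu (G t) (derive1 G t).

(* Main.v *)
(* Put I = G . J G and let r be the velocity-dependent part of the body angular
   velocity, w = r + (mu / I) G with r = V x G - b G, which is J-orthogonal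
   to G. In these variables the Routhian is r . J r / 2 - mu^2 / (2 I)
   + m g G . rho, and the Euler-Lagrange operator with magnetic term is, modulo
   G, the vector G x (N - J r'), where N is the bracketed torque in [Sigma] and
   r' the time derivative of r. As G . N = G . J r' always holds, that operator
   vanishes on the tangent plane iff J r' = N, which is the reduced equation
   and follows from the equations of the pendulum. The converse part tests the
   variational equation on rotations of the curve about a coordinate axis by
   the angle e phi(t), phi a bump function of class C^2. *)
Require Import Defs.
From HB Require Import structures.
From mathcomp Require Import all_boot all_order all_algebra.
From mathcomp Require Import all_classical all_reals all_analysis.
From mathcomp Require Import ring lra.

Import Order.TTheory GRing.Theory Num.Theory.
Import numFieldNormedType.Exports.

Local Open Scope classical_set_scope.
Local Open Scope ring_scope.

(** * Vectors and rotations *)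

(** [is_routhian] and [is_magnetic_form] constrain [Rmu] and [beta] only through lifts to SO(3), so
    the closed formulas need two existence facts: every tangent vector of the sphere lifts to one of
    momentum [mu], and every tangent vector of SO(3) is carried by a curve. Both rest on the Cayley
    transform; it is rational, so no matrix exponential enters. The trace of J arises twice from the
    single identity [cross_tr]: in the curvature of the connection, and when J V is eliminated from
    the pendulum equations. That both occurrences give the same c is why the magnetic form
    reproduces the reduced dynamics. The recurrent obstacle is a lost component: crossing with G
    forgets multiples of G, and the rate of nu enters J r' as a multiple of J G. Differentiating G .
    J r = 0 prescribes G . J r' = - V . J r, which is also G . N; as I > 0, pairing with G forces
    the unknown multiple to vanish. *)

Lemma sum_ord3 {V : nmodType} (F : 'I_3 -> V) : \sum_i F i = F 0 + F 1 + F 2.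
Proof.
rewrite !big_ord_recl big_ord0 addr0 addrA.
by congr (_ + F _ + F _); apply/val_inj.
Qed.

Lemma ord3_ind (P : 'I_3 -> Prop) : P 0 -> P 1 -> P 2 -> forall i, P i.
Proof.
move=> P0 P1 P2 [[|[|[|//]]] i].
- by rewrite (_ : Ordinal i = 0)//; exact/val_inj.
- by rewrite (_ : Ordinal i = 1)//; exact/val_inj.
- by rewrite (_ : Ordinal i = 2)//; exact/val_inj.
Qed.

Section vectors.
Context {R : realType}.
Implicit Types (u v w x y : 'cV[R]_3) (A : 'M[R]_3) (k : R).

Lemma dotE u v : u *d v = u 0 0 * v 0 0 + u 1 0 * v 1 0 + u 2 0 * v 2 0.
Proof. by rewrite /dot sum_ord3. Qed.

Lemma cV3P u v :
  u 0 0 = v 0 0 -> u 1 0 = v 1 0 -> u 2 0 = v 2 0 -> u = v.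
Proof. by move=> ? ? ?; apply/colP; apply: ord3_ind. Qed.

Lemma cross0E u v : (u *v v) 0 0 = u 1 0 * v 2 0 - u 2 0 * v 1 0.
Proof. by rewrite !mxE. Qed.

Lemma cross1E u v : (u *v v) 1 0 = u 2 0 * v 0 0 - u 0 0 * v 2 0.
Proof. by rewrite !mxE. Qed.

Lemma cross2E u v : (u *v v) 2 0 = u 0 0 * v 1 0 - u 1 0 * v 0 0.
Proof. by rewrite !mxE. Qed.

Lemma addcE u v i : (u + v) i 0 = u i 0 + v i 0. Proof. by rewrite mxE. Qed.
Lemma oppcE u i : (- u) i 0 = - u i 0. Proof. by rewrite mxE. Qed.
Lemma scalecE k u i : (k *: u) i 0 = k * u i 0. Proof. by rewrite mxE. Qed.
Lemma zerocE i : (0 : 'cV[R]_3) i 0 = 0. Proof. by rewrite mxE. Qed.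

Lemma mulcE A u i :
  (A *m u) i 0 = A i 0 * u 0 0 + A i 1 * u 1 0 + A i 2 * u 2 0.
Proof. by rewrite mxE sum_ord3. Qed.

Definition coordE :=
  (dotE, cross0E, cross1E, cross2E, addcE, oppcE, scalecE, zerocE).

Lemma dotC u v : u *d v = v *d u.
Proof. rewrite !coordE; ring. Qed.

Lemma dotDl u v w : (u + v) *d w = u *d w + v *d w.
Proof. rewrite !coordE; ring. Qed.

Lemma dotZl k u v : (k *: u) *d v = k * (u *d v).
Proof. rewrite !coordE; ring. Qed.

Lemma dotNl u v : (- u) *d v = - (u *d v).
Proof. rewrite !coordE; ring. Qed.

Lemma dotBl u v w : (u - v) *d w = u *d w - v *d w.
Proof. rewrite !coordE; ring. Qed.

Lemma dotDr u v w : w *d (u + v) = w *d u + w *d v.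
Proof. rewrite !coordE; ring. Qed.

Lemma dotZr k u v : u *d (k *: v) = k * (u *d v).
Proof. rewrite !coordE; ring. Qed.

Lemma dotNr u v : u *d (- v) = - (u *d v).
Proof. rewrite !coordE; ring. Qed.

Lemma dotBr u v w : w *d (u - v) = w *d u - w *d v.
Proof. rewrite !coordE; ring. Qed.

Definition dotlin := (dotDl, dotBl, dotNl, dotZl, dotDr, dotBr, dotNr, dotZr).

Lemma dotr0 u : u *d 0 = 0.
Proof. rewrite !coordE; ring. Qed.

Lemma dot0r u : 0 *d u = 0.
Proof. by rewrite dotC dotr0. Qed.

Lemma dot_mull A u v : (A *m u) *d v = u *d (A^T *m v).
Proof. rewrite !coordE !mulcE !mxE; ring. Qed.

Lemma dot_crossl u v : u *d (u *v v) = 0.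
Proof. rewrite !coordE; ring. Qed.

Lemma dot_crossr u v : v *d (u *v v) = 0.
Proof. rewrite !coordE; ring. Qed.

Lemma dot_cross_rot u v w : u *d (v *v w) = v *d (w *v u).
Proof. rewrite !coordE; ring. Qed.

Lemma crossC u v : u *v v = - (v *v u).
Proof. by apply: cV3P; rewrite !coordE; ring. Qed.

Lemma crossvv u : u *v u = 0.
Proof. by apply: cV3P; rewrite !coordE; ring. Qed.

Lemma crossDl u v w : (u + v) *v w = u *v w + v *v w.
Proof. by apply: cV3P; rewrite !coordE; ring. Qed.

Lemma crossDr u v w : w *v (u + v) = w *v u + w *v v.
Proof. by apply: cV3P; rewrite !coordE; ring. Qed.

Lemma crossBl u v w : (u - v) *v w = u *v w - v *v w.
Proof. by apply: cV3P; rewrite !coordE; ring. Qed.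

Lemma crossBr u v w : w *v (u - v) = w *v u - w *v v.
Proof. by apply: cV3P; rewrite !coordE; ring. Qed.

Lemma crossZl k u v : (k *: u) *v v = k *: (u *v v).
Proof. by apply: cV3P; rewrite !coordE; ring. Qed.

Lemma crossZr k u v : u *v (k *: v) = k *: (u *v v).
Proof. by apply: cV3P; rewrite !coordE; ring. Qed.

Lemma double_crossr u v w : u *v (v *v w) = (u *d w) *: v - (u *d v) *: w.
Proof. by apply: cV3P; rewrite !coordE; ring. Qed.

Lemma double_crossl u v w : (u *v v) *v w = (u *d w) *: v - (v *d w) *: u.
Proof. by apply: cV3P; rewrite !coordE; ring. Qed.

Lemma crossv0 u : u *v 0 = 0.
Proof. by apply: cV3P; rewrite !coordE; ring. Qed.

(** Here u x (v x w) = 0, so expanding u x (u x (v x w)) leaves only the two sides of the claim. It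
    is applied with u = G and with u = J G. *)
Lemma cross_parallel u v w :
  u *d v = 0 -> u *d w = 0 -> (u *d u) *: (v *v w) = (u *d (v *v w)) *: u.
Proof.
move=> uv uw; have := double_crossr u u (v *v w).
rewrite [u *v (v *v w)]double_crossr uv uw !scale0r subr0 crossv0.
by move/esym/eqP; rewrite subr_eq0 => /eqP.
Qed.

Lemma dot_cross_cross u v x y :
  (u *v v) *d (x *v y) = (u *d x) * (v *d y) - (u *d y) * (v *d x).
Proof. rewrite !coordE; ring. Qed.

Lemma dot_ge0 u : 0 <= u *d u.
Proof. by rewrite dotE -!expr2 !addr_ge0 ?sqr_ge0. Qed.

Lemma dot_eq0 u : u *d u = 0 -> u = 0.
Proof.
rewrite dotE -!expr2 => /eqP.
rewrite !paddr_eq0 ?addr_ge0 ?sqr_ge0// !sqrf_eq0.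
by move=> /andP[/andP[/eqP u0 /eqP u1] /eqP u2]; apply: cV3P; rewrite zerocE.
Qed.

Lemma enorm_sqr u : enorm u ^+ 2 = u *d u.
Proof. by rewrite /enorm sqr_sqrtr// dot_ge0. Qed.

(** This is the derivative at s = 0 of M u x M v = det M * M^-T (u x v) for M = 1 + s A. It is the
    source of tr J in the coefficient c. *)
Lemma cross_tr A u v :
  u *v (A *m v) + (A *m u) *v v = \tr A *: (u *v v) - A^T *m (u *v v).
Proof.
rewrite /mxtrace sum_ord3.
by apply: cV3P; rewrite !coordE !mulcE !mxE /=; ring.
Qed.

End vectors.

(** * The projection of SO(3) onto the sphere *)

Section geometry.
Context {R : realType}.
Implicit Types (a u v w x y G V X : 'cV[R]_3) (Q : 'M[R]_3) (k mu : R).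

Lemma dot_e3_mul Q u : e3 R *d (Q *m u) = Pi Q *d u.
Proof. by rewrite dotC dot_mull dotC. Qed.

Lemma hat_entries u :
  [/\ hat u 0 0 = 0, hat u 0 1 = - u 2 0, hat u 0 2 = u 1 0,
      hat u 1 0 = u 2 0 & [/\ hat u 1 1 = 0, hat u 1 2 = - u 0 0,
      hat u 2 0 = - u 1 0, hat u 2 1 = u 0 0 & hat u 2 2 = 0]].
Proof. by split; [..|split]; rewrite /hat !mxE /=; ring. Qed.

Lemma dPiE Q w : dPi Q w = Pi Q *v w.
Proof.
rewrite /dPi /Pi trmx_mul -mulmxA crossC -hatE -mulNmx.
congr (_ *m _); have [h00 h01 h02 h10 [h11 h12 h20 h21 h22]] := hat_entries w.
apply/matrixP => i j; rewrite [LHS]mxE [RHS]mxE; move: i j.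
apply: ord3_ind; apply: ord3_ind;
  by rewrite ?h00 ?h01 ?h02 ?h10 ?h11 ?h12 ?h20 ?h21 ?h22 ?oppr0 ?opprK.
Qed.

Lemma SO3_mulVr Q : SO3 Q -> Q *m Q^T = 1%:M.
Proof. by move=> [QQ _]; apply: mulmx1C. Qed.

Lemma Pi_sphere Q : SO3 Q -> sphere2 (Pi Q).
Proof.
move=> SQ; rewrite /sphere2 /Pi dot_mull trmxK mulmxA (SO3_mulVr _ SQ) mul1mx.
by rewrite coordE !mxE /=; ring.
Qed.

Lemma momentumE J Q w : momentum J Q w = Pi Q *d (J *m w).
Proof. by rewrite /momentum -mulmxA dot_e3_mul. Qed.

Lemma connection_den J Q :
  e3 R *d (Q *m J *m Q^T *m e3 R) = Pi Q *d (J *m Pi Q).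
Proof. by rewrite -!mulmxA dot_e3_mul. Qed.

Lemma mech_connection_atE J mu Q w :
  mech_connection_at J mu Q w =
  mu * ((Pi Q *d (J *m w)) / (Pi Q *d (J *m Pi Q))).
Proof. by rewrite /mech_connection_at /mech_connection momentumE connection_den. Qed.

Lemma sphere2_neq0 G : sphere2 G -> G != 0.
Proof.
move=> G1; apply/eqP => G0; move: G1; rewrite /sphere2 G0 !coordE.
by rewrite !mulr0 !addr0 => /eqP; rewrite eq_sym oner_eq0.
Qed.

Lemma tangent_crossK G V : tangent_sphere2 G V -> G *v (V *v G) = V.
Proof. by move=> [G1 GV]; rewrite double_crossr G1 GV scale1r scale0r subr0. Qed.

Lemma SO3_mul P Q : SO3 P -> SO3 Q -> SO3 (P *m Q).
Proof.
move=> [PP dP] [QQ dQ]; split; last by rewrite det_mulmx dP dQ mulr1.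
by rewrite trmx_mul -mulmxA (mulmxA P^T) PP mul1mx.
Qed.

Lemma det3E Q : \det Q =
  Q 0 0 * (Q 1 1 * Q 2 2 - Q 1 2 * Q 2 1)
  - Q 0 1 * (Q 1 0 * Q 2 2 - Q 1 2 * Q 2 0)
  + Q 0 2 * (Q 1 0 * Q 2 1 - Q 1 1 * Q 2 0).
Proof.
(* With natural numbers as indices, the ordinals of equal value produced by the nested cofactor
   expansions give the same atom for [ring]. *)
have [f Qf] : exists f : nat -> nat -> R, forall i j : 'I_3, Q i j = f i j.
  by exists (fun r c => Q (inord r) (inord c)) => i j; rewrite !inord_val.
rewrite (expand_det_row _ 0) sum_ord3 /cofactor.
rewrite !(expand_det_row _ (0 : 'I_2)) !big_ord_recl !big_ord0 /cofactor.
rewrite !det_mx11 !mxE !Qf /= /bump /=; ring.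
Qed.

(* The rotation with Rodrigues vector [a], i.e. the Cayley transform of
   [hat a]. *)
Definition cayley (a : 'cV[R]_3) : 'M[R]_3 :=
  (1 + a *d a)^-1 *:
    ((1 - a *d a)%:M + 2 *: hat a + 2 *: (a *m a^T)).

Lemma cayley_den_neq0 a : 1 + a *d a != 0.
Proof. by rewrite gt_eqF// ltr_pwDl// dot_ge0. Qed.

Lemma cayleyE a i j : cayley a i j = (1 + a *d a)^-1 *
  ((1 - a *d a) *+ (i == j) + 2 * hat a i j + 2 * (a i 0 * a j 0)).
Proof. by rewrite !mxE big_ord1 !mxE. Qed.

Lemma SO3_cayley a : SO3 (cayley a).
Proof.
have := cayley_den_neq0 a; rewrite dotE => a0.
split.
  apply/matrixP => i j; rewrite mxE sum_ord3 ![(cayley a)^T _ _]mxE !cayleyE !mxE /=.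
  move: i j; apply: ord3_ind; apply: ord3_ind; rewrite !dotE /= !mulr1n ?mulr0n; by field.
by rewrite det3E !cayleyE !mxE /= !dotE !mulr1n !mulr0n; field.
Qed.


Lemma cayley_tr_e3 (a : 'cV[R]_3) : (cayley a)^T *m e3 R =
  (1 + a *d a)^-1 *:
    ((1 - a *d a) *: e3 R - 2 *: (a *v e3 R) + (2 * a 2 0) *: a).
Proof.
apply: cV3P; rewrite mulcE ![(cayley a)^T _ _]mxE !cayleyE !mxE /= ?mulr1n ?mulr0n;
  ring.
Qed.

(** Q is the rotation about G x e3 that takes G to [e3]; only at the pole - e3 does this axis
    degenerate. *)
Lemma Pi_onto G : sphere2 G -> exists2 Q, SO3 Q & Pi Q = G.
Proof.
rewrite /sphere2 => G1; have := G1; rewrite dotE => G1'.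
have [c0|c0] := eqVneq (1 + G 2 0) 0.
  have G2 : G 2 0 = - 1 by apply/eqP; rewrite -addr_eq0 addrC c0.
  have [G0 G10] : G 0 0 = 0 /\ G 1 0 = 0.
    move: G1'; rewrite G2 mulrNN mulr1 => /(canRL (addrK _)); rewrite subrr.
    move/eqP; rewrite -!expr2 paddr_eq0 ?sqr_ge0// !sqrf_eq0.
    by move=> /andP[/eqP -> /eqP ->].
  (* At the pole, the half-turn about the first axis. *)
  pose D : 'M[R]_3 := diag_mx (\row_j [:: 1; -1; -1]`_j).
  exists D.
    split; first by rewrite tr_diag_mx mulmx_diag; apply/matrixP => i j;
      rewrite !mxE; case: eqP => // ->; move: j;
      apply: ord3_ind; rewrite /= ?mulrNN mulr1.
    by rewrite det_diag !big_ord_recl big_ord0 !mxE /=; ring.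
  rewrite /Pi tr_diag_mx; apply: cV3P; rewrite mulcE !mxE /=
     ?G0 ?G10 ?G2 ?mulr1n ?mulr0n; ring.
(* If theta is the angle between G and [e3], the length of [a] is sin theta / (1 + cos theta) = tan
   (theta / 2), as a Rodrigues vector of that rotation requires. *)
pose a := (1 + G 2 0)^-1 *: (G *v e3 R).
exists (cayley a); first exact: SO3_cayley.
have aa : a *d a = (1 - G 2 0) / (1 + G 2 0).
  rewrite /a dotE !mxE /=.
  apply: (mulIf c0); apply: (mulIf c0).
  rewrite [RHS]mulrAC divfK// !mulrDl.
  transitivity (G 1 0 * G 1 0 + G 0 0 * G 0 0); first by field.
  have -> : G 1 0 * G 1 0 + G 0 0 * G 0 0 = 1 - G 2 0 * G 2 0.
    by rewrite -G1'; ring.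
  ring.
rewrite /Pi cayley_tr_e3 aa.
have d0 : 1 + (1 - G 2 0) / (1 + G 2 0) = 2 / (1 + G 2 0) by field.
rewrite d0.
apply: cV3P; rewrite !coordE !mxE /=; by field.
Qed.

End geometry.

(** * The angular velocity split by the inertia form *)

Section inertia.
Context {R : realType} {J : 'M[R]_3} (J_inertia : inertia_matrix J).
Implicit Types (u v w G V X Y : 'cV[R]_3) (Q : 'M[R]_3).

Lemma inertia_dotC u v : u *d (J *m v) = v *d (J *m u).
Proof. by rewrite dotC dot_mull J_inertia.1. Qed.

Lemma inertia_gt0 G : sphere2 G -> 0 < G *d (J *m G).
Proof. by move=> ?; apply: J_inertia.2; exact: sphere2_neq0. Qed.

Lemma inertia_unit : J \in unitmx.
Proof.
rewrite unitmxE unitfE; apply/negP => /det0P[v v0 vJ].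
have : 0 < v^T *d (J *m v^T).
  by apply: J_inertia.2; rewrite -(inj_eq (@trmx_inj _ _ _)) trmxK trmx0.
have -> : J *m v^T = 0 by rewrite -J_inertia.1 -trmx_mul vJ trmx0.
by rewrite !coordE !mulr0 !addr0 ltxx.
Qed.

(* The angular velocity is [rel_velocity G V + coef_nu *: G]; the first
   summand is [J]-orthogonal to [G]. *)
Definition rel_velocity G V : 'cV[R]_3 := V *v G - coef_b J G V *: G.

Lemma dot_inertia_rel_velocity G V :
  sphere2 G -> G *d (J *m rel_velocity G V) = 0.
Proof.
move=> /inertia_gt0 /lt0r_neq0 I0.
rewrite /rel_velocity mulmxBr -scalemxAr dotBr dotZr /coef_b divfK//.
by rewrite inertia_dotC dotC subrr.
Qed.

Lemma dot_rel_velocity G V : sphere2 G -> G *d rel_velocity G V = - coef_b J G V.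
Proof. by move=> G1; rewrite dotBr dotZr G1 dot_crossr mulr1 sub0r. Qed.

Lemma cross_rel_velocity G V :
  tangent_sphere2 G V -> G *v rel_velocity G V = V.
Proof.
by move=> T; rewrite crossBr crossZr crossvv scaler0 subr0 tangent_crossK.
Qed.

(** The velocity of the projected curve determines w up to its component along G. The momentum is
    affine in that component with slope I > 0, so the value [mu] fixes it. *)
Lemma angular_velocityE mu Q w : SO3 Q -> momentum J Q w = mu ->
  w = rel_velocity (Pi Q) (dPi Q w) + coef_nu J mu (Pi Q) *: Pi Q.
Proof.
move=> /Pi_sphere; rewrite momentumE dPiE; move: (Pi Q) => G G1 wmu.
have I0 := lt0r_neq0 (inertia_gt0 _ G1).
have wE : w = (G *v w) *v G + (G *d w) *: G.
  by rewrite double_crossl G1 scale1r dotC subrK.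
have := wmu; rewrite {1}wE mulmxDr -scalemxAr dotDr dotZr => wmu'.
rewrite {1}wE /rel_velocity -addrA; congr (_ + _).
rewrite -scaleNr -scalerDl; congr (_ *: _).
rewrite /coef_nu -wmu' /coef_b [(J *m G) *d _]dotC (inertia_dotC G (_ *v _)).
by field.
Qed.

End inertia.

(** * Derivatives and limits *)

Section derivation_rules.
Context {R : realType} {E : normedModType R}.
Implicit Types (p v : E) (k h : E -> R) (dk dh : R).
Implicit Types (f g : E -> 'cV[R]_3) (df dg : 'cV[R]_3).

(* The class [is_derive] as a plain proposition, so that the rules below are
   not subject to instance resolution. *)
Definition has_derive {W : normedModType R} p v (f : E -> W) (df : W) : Prop :=
  derivable f p v /\ 'D_v f p = df.

Lemma has_deriveP {W : normedModType R} (f : E -> W) p v (df : W) :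
  has_derive p v f df <-> is_derive p v f df.
Proof. by split=> [[? ?]|[]]; [exact: DeriveDef|split]. Qed.

Lemma has_derive_eq {W : normedModType R} (f : E -> W) p v (df df' : W) :
  has_derive p v f df -> df = df' -> has_derive p v f df'.
Proof. by move=> ? <-. Qed.

Lemma has_derive_mxP {m n : nat} (M : E -> 'M[R]_(m, n)) p v D :
  has_derive p v M D <-> forall i j, has_derive p v (fun y => M y i j) (D i j).
Proof.
split=> [[dM <-] i j|MD].
  split; first by move/derivable_mxP : dM; exact.
  by rewrite derive_mx// mxE.
have dM : derivable M p v by apply/derivable_mxP => i j; case: (MD i j).
split=> //; rewrite derive_mx//; apply/matrixP => i j.
by rewrite mxE; case: (MD i j).
Qed.

Lemma has_derive_coord f p v df i :
  has_derive p v f df -> has_derive p v (fun y => f y i 0) (df i 0).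
Proof. by move/has_derive_mxP; exact. Qed.

Lemma has_derive_cV3 f p v df :
  has_derive p v (fun y => f y 0 0) (df 0 0) ->
  has_derive p v (fun y => f y 1 0) (df 1 0) ->
  has_derive p v (fun y => f y 2 0) (df 2 0) -> has_derive p v f df.
Proof.
move=> f0 f1 f2; apply/has_derive_mxP => i j; rewrite (ord1 j).
by move: i; apply: ord3_ind.
Qed.

Lemma has_derive_const {W : normedModType R} (c : W) p v :
  has_derive p v (fun=> c) 0.
Proof. by apply/has_deriveP; exact: is_derive_cst. Qed.

Lemma has_derive_addf {W : normedModType R} (f g : E -> W) p v (df dg : W) :
  has_derive p v f df -> has_derive p v g dg ->
  has_derive p v (fun y => f y + g y) (df + dg).
Proof. by move=> /has_deriveP ? /has_deriveP ?; apply/has_deriveP; exact: is_deriveD. Qed.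

Lemma has_derive_subf {W : normedModType R} (f g : E -> W) p v (df dg : W) :
  has_derive p v f df -> has_derive p v g dg ->
  has_derive p v (fun y => f y - g y) (df - dg).
Proof. by move=> /has_deriveP ? /has_deriveP ?; apply/has_deriveP; exact: is_deriveB. Qed.

Lemma has_derive_constr (c : R) p v : has_derive p v (fun=> c) (0 : R).
Proof. exact: has_derive_const. Qed.

Lemma has_derive_addr k h p v dk dh :
  has_derive p v k dk -> has_derive p v h dh ->
  has_derive p v (fun y => k y + h y) (dk + dh).
Proof. by move=> /has_deriveP ? /has_deriveP ?; apply/has_deriveP; exact: is_deriveD. Qed.

Lemma has_derive_subr k h p v dk dh :
  has_derive p v k dk -> has_derive p v h dh ->
  has_derive p v (fun y => k y - h y) (dk - dh).
Proof. by move=> /has_deriveP ? /has_deriveP ?; apply/has_deriveP; exact: is_deriveB. Qed.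

Lemma has_derive_mulf k h p v dk dh :
  has_derive p v k dk -> has_derive p v h dh ->
  has_derive p v (fun y => k y * h y) (dk * h p + k p * dh).
Proof.
move=> /has_deriveP kd /has_deriveP hd.
apply/has_deriveP; apply: is_derive_eq (is_deriveM kd hd) _.
by rewrite /GRing.scale /= addrC [h p * _]mulrC.
Qed.

Lemma has_derive_mulc (c : R) k p v dk :
  has_derive p v k dk -> has_derive p v (fun y => c * k y) (c * dk).
Proof.
move=> kd; have H := has_derive_mulf _ _ _ _ _ _ (has_derive_constr c p v) kd.
by apply: has_derive_eq H _; rewrite mul0r add0r.
Qed.

Lemma has_derive_divf k h p v dk dh :
  has_derive p v k dk -> has_derive p v h dh -> h p != 0 ->
  has_derive p v (fun y => k y / h y)
    ((dk * h p - k p * dh) / (h p ^+ 2)).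
Proof.
move=> kd hd h0.
have hVd : has_derive p v (fun y => (h y)^-1) (- dh / (h p ^+ 2)).
  move/has_deriveP : hd => hd.
  have dh' := @ex_derive _ _ _ _ _ _ _ hd.
  apply/has_deriveP; apply: DeriveDef; first exact: derivableV.
  rewrite deriveV// (@derive_val _ _ _ _ _ _ _ hd) /GRing.scale /=.
  by field.
by apply: has_derive_eq (has_derive_mulf _ _ _ _ _ _ kd hVd) _; field.
Qed.

Lemma has_derive_scalef k f p v dk df :
  has_derive p v k dk -> has_derive p v f df ->
  has_derive p v (fun y => k y *: f y) (dk *: f p + k p *: df).
Proof.
move=> kd /has_derive_mxP fd; apply/has_derive_mxP => i j; rewrite !mxE.
under eq_fun do rewrite mxE.
exact: has_derive_mulf.
Qed.

Lemma has_derive_mull (A : 'M[R]_3) f p v df :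
  has_derive p v f df -> has_derive p v (fun y => A *m f y) (A *m df).
Proof.
move=> fd.
have c i : has_derive p v (fun y => f y i 0) (df i 0) by exact: has_derive_coord.
have r i : has_derive p v (fun y => (A *m f y) i 0) ((A *m df) i 0).
  under eq_fun do rewrite mulcE.
  apply: has_derive_eq.
    apply: has_derive_addr; first apply: has_derive_addr;
      apply: has_derive_mulc; exact: c.
  by rewrite mulcE.
exact: has_derive_cV3.
Qed.

Lemma has_derive_dot f g p v df dg :
  has_derive p v f df -> has_derive p v g dg ->
  has_derive p v (fun y => f y *d g y) (df *d g p + f p *d dg).
Proof.
move=> /has_derive_coord fc /has_derive_coord gc; under eq_fun do rewrite dotE.
apply: has_derive_eq.
  by apply: has_derive_addr; first apply: has_derive_addr; apply: has_derive_mulf;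
    [exact: fc|exact: gc|exact: fc|exact: gc|exact: fc|exact: gc].
by rewrite !dotE; ring.
Qed.

Lemma has_derive_crossf f g p v df dg :
  has_derive p v f df -> has_derive p v g dg ->
  has_derive p v (fun y => f y *v g y) (df *v g p + f p *v dg).
Proof.
move=> /has_derive_coord fc /has_derive_coord gc; apply: has_derive_cV3.
- under eq_fun do rewrite cross0E.
  apply: has_derive_eq.
    by apply: has_derive_subr; apply: has_derive_mulf;
      [exact: fc|exact: gc|exact: fc|exact: gc].
  by rewrite !coordE; ring.
- under eq_fun do rewrite cross1E.
  apply: has_derive_eq.
    by apply: has_derive_subr; apply: has_derive_mulf;
      [exact: fc|exact: gc|exact: fc|exact: gc].
  by rewrite !coordE; ring.
- under eq_fun do rewrite cross2E.
  apply: has_derive_eq.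
    by apply: has_derive_subr; apply: has_derive_mulf;
      [exact: fc|exact: gc|exact: fc|exact: gc].
  by rewrite !coordE; ring.
Qed.

End derivation_rules.

Lemma has_derive_idr {R : realType} (t : R) : has_derive t (1 : R) (fun s : R => s) 1.
Proof. by apply/has_deriveP; exact: is_derive_id. Qed.


Section continuity_rules.
Context {R : realType} {T : Type} {F : set_system T} {FF : Filter F}.
Implicit Types (k h : T -> R) (f g : T -> 'cV[R]_3) (a b : 'cV[R]_3).

Lemma cvg_mxP {m n : nat} (M : T -> 'M[R]_(m, n)) (A : 'M[R]_(m, n)) :
  M @ F --> A <-> forall i j, M t i j @[t --> F] --> A i j.
Proof.
split=> [MA i j|MA].
  exact: (cvg_comp _ _ MA (@coord_continuous R m n i j A)).
apply/cvgrPdist_le => e e0; near=> t.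
rewrite [leLHS]/Num.Def.normr/= mx_normrE (bigmax_le _ (ltW e0))//= => i _.
rewrite !mxE/=; move: i; near: t; apply: filter_forall => /= i.
exact: ((cvgrPdist_le _ _).1 (MA i.1 i.2)).
Unshelve. all: by end_near. Qed.

Lemma cvg_coord f a i : f @ F --> a -> f t i 0 @[t --> F] --> a i 0.
Proof. by move/cvg_mxP; exact. Qed.

Lemma cvg_cV3 f a :
  f t 0 0 @[t --> F] --> a 0 0 -> f t 1 0 @[t --> F] --> a 1 0 ->
  f t 2 0 @[t --> F] --> a 2 0 -> f @ F --> a.
Proof.
move=> f0 f1 f2; apply/cvg_mxP => i j; rewrite (ord1 j).
by move: i; apply: ord3_ind.
Qed.

Lemma cvg_dot f g a b :
  f @ F --> a -> g @ F --> b -> f t *d g t @[t --> F] --> a *d b.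
Proof.
move=> fa gb; under eq_fun do rewrite dotE; rewrite dotE.
by apply: cvgD; first apply: cvgD; apply: cvgM; exact: cvg_coord.
Qed.

Lemma cvg_cross f g a b :
  f @ F --> a -> g @ F --> b -> f t *v g t @[t --> F] --> a *v b.
Proof.
move=> fa gb; apply: cvg_cV3.
- under eq_fun do rewrite cross0E; rewrite cross0E.
  by apply: cvgB; apply: cvgM; exact: cvg_coord.
- under eq_fun do rewrite cross1E; rewrite cross1E.
  by apply: cvgB; apply: cvgM; exact: cvg_coord.
- under eq_fun do rewrite cross2E; rewrite cross2E.
  by apply: cvgB; apply: cvgM; exact: cvg_coord.
Qed.

Lemma cvg_mull (A : 'M[R]_3) f a :
  f @ F --> a -> A *m f t @[t --> F] --> A *m a.
Proof.
move=> fa.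
have r i : (A *m f t) i 0 @[t --> F] --> (A *m a) i 0.
  under eq_fun do rewrite mulcE; rewrite mulcE.
  by apply: cvgD; first apply: cvgD; apply: cvgMr; exact: cvg_coord.
exact: cvg_cV3.
Qed.

Lemma cvg_scale k f (c : R) a :
  k @ F --> c -> f @ F --> a -> k t *: f t @[t --> F] --> c *: a.
Proof. exact: cvgZ. Qed.

Lemma cvg_div k h (c d : R) : d != 0 ->
  k @ F --> c -> h @ F --> d -> k t / h t @[t --> F] --> c / d.
Proof. by move=> d0 kc hd; apply: cvgM => //; exact: cvgV. Qed.

End continuity_rules.

(** * The Routhian and the magnetic form *)

Section routhian.
Context {R : realType} {J : 'M[R]_3} (J_inertia : inertia_matrix J).
Context (m g mu : R) (rho : 'cV[R]_3).
Implicit Types (G V X Y eta zeta : 'cV[R]_3) (Q : 'M[R]_3).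

Definition reduced_routhian G V : R :=
  2^-1 * ((V *v G) *d (J *m (V *v G)))
  - 2^-1 * (coef_b J G V ^+ 2 + coef_nu J mu G ^+ 2) * (G *d (J *m G))
  + m * g * (G *d rho).

(** For w = r + nu G the cross term of the kinetic energy vanishes, so the vertical part contributes
    mu^2 / (2 I), from which the connection takes mu^2 / I. The term in b^2 comes from r . J r = Y .
    J Y - b^2 I with Y = V x G. *)
Lemma reduced_routhianP Q w : SO3 Q -> momentum J Q w = mu ->
  reduced_routhian (Pi Q) (dPi Q w) =
  lagrangian J m g rho Q w - mech_connection_at J mu Q w.
Proof.
move=> SQ wmu; rewrite mech_connection_atE -momentumE wmu /lagrangian.
have := angular_velocityE J_inertia _ _ _ SQ wmu.
rewrite -/(Pi Q); have := Pi_sphere _ SQ.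
move: (Pi Q) (dPi Q w) => G V G1 ->.
have I0 := lt0r_neq0 (inertia_gt0 J_inertia _ G1).
rewrite /reduced_routhian /rel_velocity /coef_b /coef_nu.
rewrite !(mulmxDr, mulmxN) -!scalemxAr !dotlin.
rewrite !(inertia_dotC J_inertia (V *v G) G) ![(J *m G) *d _]dotC.
rewrite !(inertia_dotC J_inertia (V *v G) G) [rho *d G]dotC.
by field.
Qed.

(** Over any Q above G, r already projects to V; adding nu G does not change the projection, and it
    gives the momentum [mu] because r is J-orthogonal to G. *)
Lemma routhianE Rmu : is_routhian J m g rho mu Rmu ->
  forall G V, tangent_sphere2 G V -> Rmu G V = reduced_routhian G V.
Proof.
move=> RP G V [G1 GV]; have [Q SQ QG] := Pi_onto _ G1.
pose w := rel_velocity (J := J) G V + coef_nu J mu G *: G.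
have I0 := lt0r_neq0 (inertia_gt0 J_inertia _ G1).
have wmu : momentum J Q w = mu.
  rewrite momentumE QG mulmxDr -scalemxAr dotDr dotZr.
  by rewrite dot_inertia_rel_velocity// add0r /coef_nu divfK.
have dw : dPi Q w = V.
  by rewrite dPiE QG crossDr crossZr crossvv scaler0 addr0 cross_rel_velocity.
by rewrite -QG -dw (RP _ _ SQ wmu) reduced_routhianP.
Qed.

(* The derivative of [G |-> mu * (G *d (J *m zeta) / (G *d (J *m G)))], which
   gives the connection, along [G *v eta]. *)
Definition dconnection G eta zeta : R :=
  mu * ((((G *v eta) *d (J *m zeta)) * (G *d (J *m G))
         - (G *d (J *m zeta)) * (2 * ((G *v eta) *d (J *m G))))
        / (G *d (J *m G)) ^+ 2).

Lemma has_derive_Pi (C : R -> 'M[R]_3) (t : R) D :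
  has_derive t (1 : R) C D -> has_derive t (1 : R) (fun s => Pi (C s)) (Pi D).
Proof.
have PiE Q i : Pi Q i 0 = Q 2 i by rewrite mulcE !mxE /=; ring.
move=> /has_derive_mxP CD; apply/has_derive_mxP => i j; rewrite (ord1 j) PiE.
by under eq_fun do rewrite PiE; exact: CD.
Qed.

Lemma connection_derivative Q eta zeta : SO3 Q ->
  is_derivative_along (fun P => mech_connection_at J mu P zeta) Q eta
    (dconnection (Pi Q) eta zeta).
Proof.
move=> SQ C SC C0 /has_deriveP /has_derive_Pi dC.
rewrite /comp; under eq_fun do rewrite mech_connection_atE.
apply/has_deriveP.
have I0 : Pi (C 0) *d (J *m Pi (C 0)) != 0.
  by rewrite lt0r_neq0// inertia_gt0//; exact: Pi_sphere.
apply: has_derive_eq.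
  apply: has_derive_mulc; apply: has_derive_divf; last exact: I0.
    by apply: has_derive_dot; [exact: dC|exact: has_derive_const].
  by apply: has_derive_dot; [exact: dC|apply: has_derive_mull; exact: dC].
move: I0; rewrite C0 -/(dPi Q eta) dPiE /dconnection dotr0 addr0 => I0.
rewrite (inertia_dotC J_inertia (Pi Q) (_ *v _)); congr (_ * (_ / _)); ring.
Qed.

Lemma hatZ (k : R) eta : hat (k *: eta) = k *: hat eta.
Proof.
apply/matrixP => i j; rewrite [LHS]mxE crossZl scalecE [RHS]mxE.
by congr (_ * _); rewrite [RHS]mxE.
Qed.

(** To first order [cayley a] is 1 + 2 hat a, whence the factor 1/2. *)
Lemma has_derive_cayley eta :
  has_derive (0 : R) (1 : R) (fun s => cayley ((s / 2) *: eta)) (hat eta).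
Proof.
apply/has_derive_mxP => i j.
pose n := eta *d eta; pose e := (i == j)%:R : R; pose q := eta i 0 * eta j 0.
(* Each entry is a rational function of s, and s * s has derivative 0 at 0. *)
have E s : cayley ((s / 2) *: eta) i j =
    (e + s * hat eta i j + s * s * ((2 * q - n * e) / 4)) / (1 + s * s * (n / 4)).
  rewrite cayleyE !scalecE hatZ [(_ *: hat eta) i j]mxE dotZl dotZr -/n mulrC.
  have -> : 1 + s / 2 * (s / 2 * n) = 1 + s * s * (n / 4) by field.
  congr (_ / _); rewrite -mulr_natr -/e.
  by rewrite /q; field.
under eq_fun do rewrite E.
have dS : has_derive (0 : R) (1 : R) (fun s : R => s * s) (0 : R).
  apply: has_derive_eq; first by apply: has_derive_mulf; exact: has_derive_idr.
  by rewrite mulr0 mul0r addr0.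
apply: has_derive_eq.
  apply: has_derive_divf.
  - apply: has_derive_addr; first apply: has_derive_addr.
    + exact: has_derive_constr.
    + by apply: has_derive_mulf; [exact: has_derive_idr|exact: has_derive_constr].
    + by apply: has_derive_mulf; [exact: dS|exact: has_derive_constr].
  - apply: has_derive_addr; first exact: has_derive_constr.
    by apply: has_derive_mulf; [exact: dS|exact: has_derive_constr].
  - by rewrite !mul0r addr0 oner_neq0.
by rewrite /=; field.
Qed.

Lemma rotation_curve Q eta : SO3 Q -> exists C : R -> 'M[R]_3,
  [/\ forall s, SO3 (C s), C 0 = Q &
      is_derive (0 : R) (1 : R) C (Q *m hat eta)].
Proof.
move=> SQ; exists (fun s => Q *m cayley ((s / 2) *: eta)); split.
- by move=> s; apply: SO3_mul => //; exact: SO3_cayley.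
- rewrite mul0r -[RHS]mulmx1; congr (_ *m _).
  apply/matrixP => i j.
  rewrite cayleyE hatZ dotZl !scalecE [(_ *: hat _) i j]mxE [RHS]mxE.
  by rewrite !mul0r !mulr0 !addr0 subr0 invr1 mul1r.
- apply/has_deriveP/has_derive_mxP => i j.
  have /has_derive_mxP dcay := has_derive_cayley eta.
  rewrite mxE sum_ord3; under eq_fun do rewrite mxE sum_ord3.
  by apply: has_derive_addr; first apply: has_derive_addr;
    apply: has_derive_mulc; exact: dcay.
Qed.

(** The triple product is the area form of the sphere. The factor - mu / I^2 * (- I tr J + 2 |J
    G|^2) of the theorem equals [coef_c], so the term c V in Sigma is the gyroscopic force of this
    form. *)
Definition magnetic_form G X Y : R := coef_c J mu G * (G *d (X *v Y)).

(** With a = J G and n = eta x zeta, the terms in a . n have the coefficients - 1 (numerator), + 2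
    (denominator) and - 1 (Lie bracket), in units of mu / I. They cancel, leaving a multiple of G .
    n, as a form induced from the sphere must. *)
Lemma dconnectionE Q eta zeta : SO3 Q ->
  dconnection (Pi Q) eta zeta - dconnection (Pi Q) zeta eta
    - mech_connection_at J mu Q (eta *v zeta) =
  coef_c J mu (Pi Q) * (Pi Q *d (eta *v zeta)).
Proof.
move=> SQ; rewrite mech_connection_atE.
have := Pi_sphere _ SQ; move: (Pi Q) => G G1.
have := lt0r_neq0 (inertia_gt0 J_inertia _ G1).
rewrite /coef_c /coef_nu enorm_sqr /dconnection.
set I := G *d (J *m G); set n := eta *v zeta; set a := J *m G => I0.
have tr_id : (G *v eta) *d (J *m zeta) - (G *v zeta) *d (J *m eta) =
    \tr J * (G *d n) - a *d n.
  transitivity (G *d (eta *v (J *m zeta) + (J *m eta) *v zeta)).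
    by rewrite !coordE; ring.
  rewrite cross_tr J_inertia.1 dotBr dotZr -/n (inertia_dotC J_inertia G) /a.
  by rewrite [RHS]addrC [in RHS]dotC addrC.
(* The left side is a . (G x (a x n)): the two products combine through the expansion of a x (eta x
   zeta). *)
have ct_id : (G *d (J *m zeta)) * ((G *v eta) *d a)
    - (G *d (J *m eta)) * ((G *v zeta) *d a) = (a *d a) * (G *d n) - (a *d n) * I.
  rewrite (inertia_dotC J_inertia G zeta) (inertia_dotC J_inertia G eta) -/a.
  by rewrite /I -/a /n !coordE; ring.
have -> : G *d (J *m n) = a *d n by rewrite (inertia_dotC J_inertia) dotC.
transitivity (mu * (((G *v eta) *d (J *m zeta) - (G *v zeta) *d (J *m eta)) * I
  - 2 * ((G *d (J *m zeta)) * ((G *v eta) *d a)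
    - (G *d (J *m eta)) * ((G *v zeta) *d a)) - a *d n * I) / I ^+ 2).
  by field.
by rewrite tr_id ct_id; field.
Qed.

Lemma cross_cross_sphere G eta zeta : sphere2 G ->
  G *d ((G *v eta) *v (G *v zeta)) = G *d (eta *v zeta).
Proof.
move=> G1; rewrite double_crossl !dotlin G1 dot_crossl mul0r sub0r mulr1.
by rewrite dot_cross_rot crossC dotNr opprK.
Qed.

Lemma magnetic_formP : is_magnetic_form J mu magnetic_form.
Proof.
move=> Q eta zeta SQ.
exists (dconnection (Pi Q) eta zeta), (dconnection (Pi Q) zeta eta).
split; [exact: connection_derivative|exact: connection_derivative|].
rewrite dconnectionE// /magnetic_form !dPiE cross_cross_sphere//.
exact: Pi_sphere.
Qed.

Lemma magnetic_formE beta : is_magnetic_form J mu beta ->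
  forall G eta zeta, sphere2 G ->
  beta G (G *v eta) (G *v zeta) = coef_c J mu G * (G *d (eta *v zeta)).
Proof.
move=> betaP G eta zeta /Pi_onto[Q SQ QG].
have [x [y [dx dy]]] := betaP Q eta zeta SQ; rewrite !dPiE QG => ->.
(* [is_derivative_along] quantifies over all curves; a single curve with the given velocity already
   determines the value. *)
have uniq xi chi z :
    is_derivative_along (fun P => mech_connection_at J mu P chi) Q xi z ->
    z = dconnection (Pi Q) xi chi.
  move=> dz; have [C [SC C0 dC]] := rotation_curve _ xi SQ.
  have [_ <-] := (has_deriveP _ _ _ _).2 (dz _ SC C0 dC).
  have := connection_derivative _ xi chi SQ _ SC C0 dC.
  by move/has_deriveP => [_ ->].
by rewrite (uniq _ _ _ dx) (uniq _ _ _ dy) dconnectionE// QG.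
Qed.

End routhian.

(** * Calculus in one and two variables *)

Section plane_calculus.
Context {R : realType}.
Implicit Types (e t : R) (p : R * R).

Lemma has_derive_fst {W : normedModType R} (F : R * R -> W) e t (l : W) :
  has_derive (e, t) ((1, 0) : R * R) F l <->
  has_derive e (1 : R) (fun x => F (x, t)) l.
Proof.
have E : (fun h : R => h^-1 *: (F (h *: ((1, 0) : R * R) + (e, t)) - F (e, t))) =
         (fun h : R => h^-1 *: (F (h *: (1 : R) + e, t) - F (e, t))).
  apply/funext => h; congr (_ *: (F _ - _)).
  have -> : h *: ((1, 0) : R * R) + (e, t) = (h *: (1 : R) + e, h *: (0 : R) + t) by [].
  by rewrite scaler0 add0r.
by rewrite /has_derive /derivable /derive E.
Qed.

Lemma has_derive_snd {W : normedModType R} (F : R * R -> W) e t (l : W) :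
  has_derive (e, t) ((0, 1) : R * R) F l <->
  has_derive t (1 : R) (fun y => F (e, y)) l.
Proof.
have E : (fun h : R => h^-1 *: (F (h *: ((0, 1) : R * R) + (e, t)) - F (e, t))) =
         (fun h : R => h^-1 *: (F (e, h *: (1 : R) + t) - F (e, t))).
  apply/funext => h; congr (_ *: (F _ - _)).
  have -> : h *: ((0, 1) : R * R) + (e, t) = (h *: (0 : R) + e, h *: (1 : R) + t) by [].
  by rewrite scaler0 add0r.
by rewrite /has_derive /derivable /derive E.
Qed.

Lemma has_derive_continuous {W : normedModType R} (f : R -> W) t (l : W) :
  has_derive t (1 : R) f l -> {for t, continuous f}.
Proof. by move=> [/derivable1_diffP/differentiable_continuous]. Qed.

Lemma has_derive_chain (f g : R -> R) t (a b : R) :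
  has_derive (g t) (1 : R) f a -> has_derive t (1 : R) g b ->
  has_derive t (1 : R) (fun s => f (g s)) (a * b).
Proof.
by move=> /has_deriveP fa /has_deriveP gb; apply/has_deriveP; exact: is_derive1_comp.
Qed.

Lemma mean_value_le (g g1 : R -> R) (a b M : R) :
  (forall z, Num.min a b <= z <= Num.max a b ->
     has_derive z (1 : R) g (g1 z) /\ `|g1 z| <= M) ->
  `|g b - g a| <= M * `|b - a|.
Proof.
wlog ab : a b / a <= b => [H gP|].
  case: (leP a b) => [/H|/ltW/H]; first exact.
  by rewrite distrC [`|b - a|]distrC; apply => z zab; apply: gP; rewrite minC maxC.
rewrite min_l// max_r// => gP.
have [||c] := @MVT_segment _ g g1 a b ab.
- move=> z; rewrite in_itv /= => /andP[/ltW az /ltW zb]; apply/has_deriveP.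
  by apply: (gP z _).1; rewrite az.
- apply: derivable_within_continuous => z; rewrite in_itv /= => /gP[[]].
  by [].
rewrite in_itv /= => /gP[_ g1M] ->; rewrite normrM.
by rewrite ler_wpM2r.
Qed.

(** Continuity of the function itself is not part of [C1_on]. The first partial, bounded near the
    point, makes f Lipschitz in the first variable uniformly over nearby slices; the second partial
    handles the slice through the point. *)
Lemma continuous_of_partials (f f1 : R * R -> R) e t :
  (\forall q \near (e, t), has_derive q ((1, 0) : R * R) f (f1 q)) ->
  {for (e, t), continuous f1} ->
  derivable f (e, t) ((0, 1) : R * R) ->
  {for (e, t), continuous f}.
Proof.
move=> near_f1 cf1 df2.
have cslice : {for t, continuous (fun y => f (e, y))}.
  have /has_derive_snd : has_derive (e, t) ((0, 1) : R * R) f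
    ('D_((0, 1) : R * R) f (e, t)) by [].
  exact: has_derive_continuous.
have bound : \forall q \near (e, t), `|f1 q| <= `|f1 (e, t)| + 1.
  move/cvgrPdist_le : cf1 => /(_ 1 ltr01); apply: filterS => q.
  move=> h; rewrite -[f1 q](subrK (f1 (e, t))) addrC (le_trans (ler_normD _ _))//.
  by rewrite lerD2l distrC.
set M := `|f1 (e, t)| + 1 in bound.
have M0 : 0 < M by rewrite ltr_wpDl.
have [r /= r0 rP] : exists2 r : R, 0 < r & forall q, ball (e, t) r q ->
    has_derive q ((1, 0) : R * R) f (f1 q) /\ `|f1 q| <= M.
  have : \forall q \near (e, t),
    has_derive q ((1, 0) : R * R) f (f1 q) /\ `|f1 q| <= M by exact: filterI.
  by move=> /nbhs_ballP[r]; exists r.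
apply/cvgrPdist_le => eps eps0.
have near_y : \forall q \near (e, t), `|f (e, q.2) - f (e, t)| <= eps / 2.
  have c2 : f (e, q.2) @[q --> (e, t)] --> f (e, t).
    apply: (@cvg_comp _ _ _ (fun q : R * R => q.2) (fun y => f (e, y)) _ (nbhs t)).
      exact: cvg_snd.
    exact: cslice.
  move/cvgrPdist_le : c2 => /(_ (eps / 2)).
  rewrite divr_gt0// => /(_ isT).
  by apply: filterS => q; rewrite distrC.
have near_x : \forall q \near (e, t), `|q.1 - e| <= eps / 2 / M.
  have c1 : q.1 @[q --> (e, t)] --> e by exact: cvg_fst.
  move/cvgrPdist_le : c1 => /(_ (eps / 2 / M)).
  rewrite !divr_gt0// => /(_ isT).
  by apply: filterS => q; rewrite distrC.
have near_r : \forall q \near (e, t), ball (e, t) r q by exact: nbhsx_ballx.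
apply: filterS3 near_r near_x near_y => -[x y] [/= xr yr] q1 q2.
have fx : `|f (x, y) - f (e, y)| <= M * `|x - e|.
  apply: (@mean_value_le (fun z => f (z, y)) (fun z => f1 (z, y))) => z zx.
  have [] := rP (z, y); last by move=> /has_derive_fst.
  split => //=; move: xr; rewrite /ball /= => xr.
  apply: le_lt_trans xr.
  move: zx; rewrite ge_min le_max; case: (leP e x) => ex zx.
    rewrite (ler0_norm (x := e - z)); last lra.
    by rewrite ler0_norm; lra.
  rewrite ger0_norm; last lra.
  by rewrite ger0_norm; lra.
rewrite distrC -(subrKA (f (e, y))) (le_trans (ler_normD _ _))//.
rewrite [eps]splitr lerD// (le_trans fx)//.
by rewrite mulrC -ler_pdivlMr.
Qed.

Lemma bounded_on_rectangle (f : R * R -> R) (a b c d : R) :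
  (forall e t, a <= e <= b -> c <= t <= d -> {for (e, t), continuous f}) ->
  exists2 M : R, 0 < M & forall e t, a <= e <= b -> c <= t <= d -> `|f (e, t)| <= M.
Proof.
move=> cf.
have : compact (f @` (`[a, b] `*` `[c, d])).
  apply: continuous_compact; last by apply: compact_setX; exact: segment_compact.
  apply: continuous_in_subspaceT => -[e t].
  by rewrite inE /= !in_itv /= => -[? ?]; exact: cf.
move=> /compact_bounded/ex_strict_bound_gt0[M M0 fM].
exists M => // e t eab tcd; apply/ltW/fM.
by exists (e, t) => //; split; rewrite /= in_itv.
Qed.

Lemma leibniz_rule (f f1 : R * R -> R) (d T : R) : 0 < d ->
  (forall e t, - d < e < d -> 0 <= t <= T ->
     has_derive e (1 : R) (fun x => f (x, t)) (f1 (e, t))) ->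
  (forall e t, - d < e < d -> 0 <= t <= T ->
     {for t, continuous (fun y => f (e, y))}) ->
  (forall e t, - d < e < d -> 0 <= t <= T -> {for (e, t), continuous f1}) ->
  is_derive (0 : R) (1 : R)
    (fun e => \int[lebesgue_measure]_(t in `[0, T]) f (e, t))
    (\int[lebesgue_measure]_(t in `[0, T]) f1 (0, t)).
Proof.
move=> d0 df cf cf1.
(* Halving d gives a compact rectangle inside the strip; the bound of [f1] there is the dominating
   constant. *)
have [|M M0 f1M] := @bounded_on_rectangle f1 (- (d / 2)) (d / 2) 0 T.
  by move=> e t ed tT; apply: cf1 => //; lra.
have Id e : `]- (d / 2), d / 2[%classic e -> - d < e < d.
  by rewrite /= in_itv /= => /andP[? ?]; lra.
have IT (t : R) : `[0, T]%classic t -> 0 <= t <= T by rewrite /= in_itv.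
have integrable_cst (c : R) :
    lebesgue_measure.-integrable (`[0, T] : set R) (EFin \o (fun=> c)).
  apply: continuous_compact_integrable; first exact: segment_compact.
  by apply: continuous_subspaceT => ?; exact: cvg_cst.
have int_f e : `]- (d / 2), d / 2[%classic e ->
    lebesgue_measure.-integrable (`[0, T] : set R) (EFin \o (fun t => f (e, t))).
  move=> /Id ed; apply: continuous_compact_integrable; first exact: segment_compact.
  apply: continuous_in_subspaceT => t; rewrite inE => /IT tT; exact: cf.
have f1E e t : `]- (d / 2), d / 2[%classic e -> `[0, T]%classic t ->
    derivable (fun x => f (x, t)) e 1 /\
    partial1of2 (fun x y => f (x, y)) e t = f1 (e, t).
  move=> /Id ed /IT tT; have [? ?] := df _ _ ed tT.
  by split => //; rewrite partial1of2E.
have I0 : `]- (d / 2), d / 2[%classic (0 : R) by rewrite /= in_itv /=; lra.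
have der e t (h1 : `]- (d / 2), d / 2[%classic e) (h2 : `[0, T]%classic t) :=
  (f1E e t h1 h2).1.
have bnd e t : `]- (d / 2), d / 2[%classic e -> `[0, T]%classic t ->
    `|partial1of2 (fun x y => f (x, y)) e t| <= M.
  move=> h1 h2; rewrite (f1E e t h1 h2).2; apply: f1M; last exact: IT.
  by move: h1; rewrite /= in_itv /= => /andP[/ltW -> /ltW ->].
have D := @derivable_under_integral R _ _ lebesgue_measure
  (fun e t => f (e, t)) _ (measurable_itv `[0, T]) _ _ _
  I0 int_f der (fun=> M) (fun=> ltW M0) (integrable_cst M) bnd.
have V := @differentiation_under_integral R _ _ lebesgue_measure
  (fun e t => f (e, t)) _ (measurable_itv `[0, T]) _ _ _
  I0 int_f der (fun=> M) (fun=> ltW M0) (integrable_cst M) bnd.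
apply: DeriveDef; first exact: D.
rewrite -derive1E; apply: (etrans V).
by apply: eq_Rintegral => t; rewrite inE => tT; rewrite (f1E 0 t I0 tT).2.
Qed.

End plane_calculus.

(** * Integrals over a segment and the fundamental lemma of the calculus of variations *)

Section segment_integrals.
Context {R : realType}.
Implicit Types (f h : R -> R) (a b s t T : R).

Lemma integrable_segment f a b :
  (forall t, a <= t <= b -> {for t, continuous f}) ->
  lebesgue_measure.-integrable (`[a, b]%classic : set R) (EFin \o f).
Proof.
move=> cf; apply: continuous_compact_integrable; first exact: segment_compact.
by apply: continuous_in_subspaceT => t; rewrite inE /= in_itv /=; exact: cf.
Qed.

Lemma Rintegral_derivative f (g : R -> R) a b : a < b ->
  (forall t, a <= t <= b -> has_derive t (1 : R) f (g t)) ->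
  (forall t, a <= t <= b -> {for t, continuous g}) ->
  \int[lebesgue_measure]_(t in `[a, b]) g t = f b - f a.
Proof.
move=> ab fg cg; rewrite /Rintegral (@continuous_FTC2 _ g f a b)//.
- by apply: continuous_in_subspaceT => t; rewrite inE /= in_itv /=; exact: cg.
- split.
  + move=> t; rewrite in_itv /= => /andP[/ltW at_ /ltW tb].
    by have [] := fg t; first by rewrite at_.
  + by apply: cvg_at_right_filter; apply: has_derive_continuous (fg a _); rewrite lexx ltW.
  + by apply: cvg_at_left_filter; apply: has_derive_continuous (fg b _); rewrite lexx ltW.
- move=> t; rewrite in_itv /= => /andP[/ltW at_ /ltW tb].
  by rewrite derive1E; have [] := fg t; first by rewrite at_.
Qed.

Lemma near_segment f s T : 0 < T -> 0 <= s <= T -> {for s, continuous f} ->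
  0 < f s -> exists a b, [/\ 0 <= a, a < b, b <= T &
    forall t, a <= t <= b -> f s / 2 < f t].
Proof.
move=> T0 /andP[s0 sT] /cvgrPdist_lt cf fs0.
have := cf (f s / 2); rewrite divr_gt0// => /(_ isT) H.
have [d /= d0 dP] : exists2 d : R, 0 < d & forall t, ball s d t -> `|f s - f t| < f s / 2.
  by move: H => /nbhs_ballP[d]; exists d.
(* Clipped to [0, T], the interval stays nondegenerate even when s is an endpoint. *)
exists (Num.max 0 (s - d / 2)), (Num.min T (s + d / 2)); split.
- by rewrite le_max lexx.
- by rewrite gt_max !lt_min; apply/andP; split; apply/andP; split; lra.
- by rewrite ge_min lexx.
- move=> t; rewrite ge_max le_min => /andP[/andP[t0 td] /andP[tT tsd]].
  have /dP : ball s d t by rewrite /ball /= ltr_norml; apply/andP; split; lra.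
  by rewrite ltr_norml => /andP[? ?]; lra.
Qed.

Lemma continuous_Rintegral_eq0 f T : 0 < T ->
  (forall t, 0 <= t <= T -> {for t, continuous f}) ->
  (forall t, 0 <= t <= T -> 0 <= f t) ->
  \int[lebesgue_measure]_(t in `[0, T]) f t = 0 ->
  forall t, 0 <= t <= T -> f t = 0.
Proof.
move=> T0 cf f0 If s sT; apply/eqP; rewrite eq_le f0// andbT leNgt.
apply/negP => fs0; have [a [b [a0 ab bT fab]]] := near_segment _ _ _ T0 sT (cf s sT) fs0.
have intf := integrable_segment _ _ _ cf.
have /integrableP[mf _] := intf.
have If0 : (\int[lebesgue_measure]_(t in `[0%R, T]) (f t)%:E = 0)%E.
  by rewrite -(fineK (integrable_fin_num _ intf))//; congr EFin.
have sub : `[a, b]%classic `<=` (`[0, T]%classic : set R).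
  by move=> t; rewrite /= !in_itv /= => /andP[? ?]; apply/andP; split; lra.
have f0' (t : R) : `[0, T]%classic t -> (0 <= (f t)%:E)%E.
  by rewrite /= in_itv /= lee_fin; exact: f0.
have /= := @ge0_subset_integral _ _ _ lebesgue_measure _ _
  (measurable_itv `[a, b]) (measurable_itv `[0, T]) _ mf f0' sub.
rewrite If0 => le0.
have : (\int[lebesgue_measure]_(t in `[a, b]) (cst (f s / 2)%:E) t <=
        \int[lebesgue_measure]_(t in `[a, b]) (f t)%:E)%E.
  apply: ge0_le_integral => //.
  - by move=> t _; rewrite lee_fin; lra.
  - exact: measurable_funS mf.
  - move=> t; rewrite /= in_itv /= => /fab ?; rewrite lee_fin; exact: ltW.
have mab : lebesgue_measure (`[a, b]%classic : set R) = (b - a)%:E.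
  by rewrite lebesgue_measure_itv /= lte_fin ab.
rewrite integral_cst// [X in (_ * X <= _)%E]mab.
move=> /le_trans/(_ le0); rewrite -EFinM lee_fin leNgt.
by rewrite mulr_gt0 ?divr_gt0 ?subr_gt0.
Qed.

Definition pos_part (x : R) : R := Num.max 0 x.

Lemma pos_part_ge0 x : 0 <= pos_part x. Proof. by rewrite le_max lexx. Qed.

Lemma pos_part_continuous : continuous pos_part.
Proof.
move=> x; have -> : pos_part = (fun y : R => (y + `|y|) / 2).
  by apply/funext => y; rewrite /pos_part maxC maxr_absE subr0 addr0.
by apply: cvgMl; apply: cvgD; [exact: cvg_id|apply: cvg_norm; exact: cvg_id].
Qed.

Lemma has_derive_pos_part n x :
  has_derive x (1 : R) (fun y => pos_part y ^+ n.+2)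
    (n.+2%:R * pos_part x ^+ n.+1).
Proof.
apply/has_deriveP; have [x0|x0|->] := ltgtP x 0.
- apply: (near_eq_is_derive (f := cst 0)); last first.
    by rewrite /pos_part max_l ?ltW// expr0n mulr0; exact: is_derive_cst.
  near=> y; rewrite /pos_part max_l ?expr0n//.
  by rewrite ltW//; near: y; exact: lt_nbhsl.
- apply: (@near_eq_is_derive R R R (fun y : R => y ^+ n.+2)); last first.
    apply: DeriveDef; first exact: exprn_derivable.
    by rewrite exp_derive /GRing.scale /= mulr1 /pos_part max_r// ltW.
  near=> y; rewrite /pos_part max_r//.
  by rewrite ltW//; near: y; exact: lt_nbhsr.
(* At 0 the difference quotient is at most |h| ^ n.+1; this is why the exponent starts at 2. *)
- have p0 : pos_part 0 = 0 by rewrite /pos_part maxxx.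
  rewrite p0 expr0n mulr0; apply/has_deriveP.
  suff H : h^-1 *: (pos_part (h *: (1 : R) + 0) ^+ n.+2 - pos_part 0 ^+ n.+2)
      @[h --> 0^'] --> (0 : R).
    by split; [apply/cvg_ex; exists 0|exact: cvg_lim H].
  apply/cvgrPdist_le => e e0; near=> h.
  have h1 : `|h| <= 1.
    by near: h; apply: dnbhs0_le.
  have he : `|h| <= e by near: h; apply: dnbhs0_le.
  have h0 : h != 0 by near: h; exact: nbhs_dnbhs_neq.
  rewrite p0 expr0n subr0 sub0r normrN /GRing.scale /= mulr1 addr0.
  rewrite normrM normfV normrX ler_pdivrMl ?normr_gt0//.
  have ph : `|pos_part h| <= `|h|.
    rewrite ger0_norm ?pos_part_ge0// /pos_part ge_max normr_ge0 /=.
    exact: ler_norm.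
  rewrite (@le_trans _ _ (`|h| ^+ n.+2))// ?lerXn2r ?nnegrE//.
  rewrite exprS ler_wpM2l// exprS (le_trans _ he)//.
  by rewrite ler_piMr// exprn_ile1.
Unshelve. all: by end_near. Qed.

(** The parabola is positive exactly on ]a, b[ when a < b. The cube is the least integer power of
    its positive part that is of class C^2 across a and b. *)
Definition cubic_bump a b t : R := pos_part ((t - a) * (b - t)) ^+ 3.
Definition cubic_bump1 a b t : R :=
  3 * pos_part ((t - a) * (b - t)) ^+ 2 * (a + b - 2 * t).
Definition cubic_bump2 a b t : R :=
  6 * pos_part ((t - a) * (b - t)) * ((a + b - 2 * t) * (a + b - 2 * t))
  - 6 * (pos_part ((t - a) * (b - t)) * pos_part ((t - a) * (b - t))).

Lemma has_derive_parabola a b t :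
  has_derive t (1 : R) (fun s => (s - a) * (b - s)) (a + b - 2 * t).
Proof.
apply: has_derive_eq.
  apply: has_derive_mulf; apply: has_derive_subr.
  - exact: has_derive_idr.
  - exact: has_derive_constr.
  - exact: has_derive_constr.
  - exact: has_derive_idr.
by rewrite /=; ring.
Qed.

Lemma has_derive_cubic_bump a b t :
  has_derive t (1 : R) (cubic_bump a b) (cubic_bump1 a b t).
Proof.
exact: has_derive_chain _ _ _ _ _ (has_derive_pos_part 1 _)
  (has_derive_parabola a b t).
Qed.

Lemma has_derive_cubic_bump1 a b t :
  has_derive t (1 : R) (cubic_bump1 a b) (cubic_bump2 a b t).
Proof.
apply: has_derive_eq.
  apply: has_derive_mulf.
    apply: has_derive_mulc.
    exact: has_derive_chain _ _ _ _ _ (has_derive_pos_part 0 _)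
      (has_derive_parabola a b t).
  apply: has_derive_subr; first exact: has_derive_constr.
  apply: has_derive_mulc; exact: has_derive_idr.
by rewrite /cubic_bump2 /=; ring.
Qed.

Lemma cubic_bump2_continuous a b : continuous (cubic_bump2 a b).
Proof.
move=> t.
have cp : pos_part ((s - a) * (b - s)) @[s --> t] --> pos_part ((t - a) * (b - t)).
  apply: continuous_cvg; first exact: pos_part_continuous.
  exact: (has_derive_continuous _ _ _ (has_derive_parabola a b t)).
have cl : a + b - 2 * s @[s --> t] --> a + b - 2 * t.
  by apply: cvgB; [exact: cvg_cst|apply: cvgMr; exact: cvg_id].
apply: cvgB; last by apply: cvgMr; exact: cvgM.
by apply: cvgM; [exact: cvgMr|exact: cvgM].
Qed.

Lemma cubic_bump_ge0 a b t : 0 <= cubic_bump a b t.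
Proof. by rewrite exprn_ge0 ?pos_part_ge0. Qed.

Lemma cubic_bump_gt0 a b t : a < t < b -> 0 < cubic_bump a b t.
Proof.
move=> /andP[at_ tb]; rewrite exprn_gt0// lt_max; apply/orP; right.
by rewrite mulr_gt0// subr_gt0.
Qed.

Lemma cubic_bump_eq0 a b t : a <= b -> ~~ (a < t < b) -> cubic_bump a b t = 0.
Proof.
move=> ab tab; rewrite /cubic_bump /pos_part max_l ?expr0n//.
move: tab; rewrite negb_and -!leNgt => /orP[ta|bt]; nra.
Qed.

Lemma fundamental_lemma h T : 0 < T ->
  (forall t, 0 <= t <= T -> {for t, continuous h}) ->
  (forall a b, 0 <= a -> a < b -> b <= T ->
    \int[lebesgue_measure]_(t in `[0, T]) (cubic_bump a b t * h t) = 0) ->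
  forall t, 0 <= t <= T -> h t = 0.
Proof.
(* A one-sided bound suffices: it is applied to h and to - h. *)
move=> T0; suff pos k : (forall t, 0 <= t <= T -> {for t, continuous k}) ->
    (forall a b, 0 <= a -> a < b -> b <= T ->
      \int[lebesgue_measure]_(t in `[0, T]) (cubic_bump a b t * k t) = 0) ->
    forall t, 0 <= t <= T -> k t <= 0.
  move=> ch Ih t tT; apply/eqP; rewrite eq_le pos//= -oppr_le0.
  apply: (pos (fun t => - h t)) tT => [s sT|a b a0 ab bT].
    by apply: cvgN; exact: ch.
  have ci s : 0 <= s <= T -> {for s, continuous (fun t => cubic_bump a b t * h t)}.
    move=> sT; apply: cvgM; last exact: ch.
    exact: (has_derive_continuous _ _ _ (has_derive_cubic_bump a b s)).
  under eq_Rintegral do rewrite mulrN -mulN1r.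
  by rewrite RintegralZl// ?Ih ?mulr0//; exact: integrable_segment.
move=> ck Ik s sT; rewrite leNgt; apply/negP => ks0.
have [a [b [a0 ab bT kab]]] := near_segment _ _ _ T0 sT (ck s sT) ks0.
have mT : 0 <= (a + b) / 2 <= T by lra.
(* On [a, b] the function k is positive, and off it the bump vanishes. The integrand is thus
   nonnegative with integral 0, hence 0 at the midpoint, where both factors are positive. *)
have : cubic_bump a b ((a + b) / 2) * k ((a + b) / 2) = 0.
  apply: (continuous_Rintegral_eq0 (fun t => cubic_bump a b t * k t) T T0) => //.
  - move=> t tT; apply: cvgM; last exact: ck.
    exact: (has_derive_continuous _ _ _ (has_derive_cubic_bump a b t)).
  - move=> t tT; have [tab|tab] := boolP (a < t < b).
      rewrite mulr_ge0 ?cubic_bump_ge0// ltW// (le_lt_trans _ (kab t _))//; lra.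
    by rewrite cubic_bump_eq0 ?mul0r// ltW.
  - exact: Ik.
apply/eqP; rewrite mulf_neq0// gt_eqF//; first by apply: cubic_bump_gt0; lra.
by rewrite (le_lt_trans _ (kab _ _))//; lra.
Qed.

End segment_integrals.

(** * The Euler-Lagrange operator *)

Section euler_lagrange_algebra.
Context {R : realType} {J : 'M[R]_3} (J_inertia : inertia_matrix J).
Context (m g mu : R) (rho : 'cV[R]_3).
Implicit Types (G V A X : 'cV[R]_3).

Definition dcoef_b G V A : R :=
  (((J *m V) *d (V *v G) + (J *m G) *d (A *v G)) * (G *d (J *m G))
   - ((J *m G) *d (V *v G)) * (V *d (J *m G) + G *d (J *m V)))
  / (G *d (J *m G)) ^+ 2.

Definition rel_acceleration G V A : 'cV[R]_3 :=
  A *v G - (dcoef_b G V A *: G + coef_b J G V *: V).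

(** The fibre derivative of the Routhian: the variation W of the velocity enters through (W x G) . J
    r = W . (G x J r). *)
Definition routh_momentum G V : 'cV[R]_3 :=
  G *v (J *m rel_velocity (J := J) G V).

Definition drouth_momentum G V A : 'cV[R]_3 :=
  V *v (J *m rel_velocity (J := J) G V) + G *v (J *m rel_acceleration G V A).

(** The gradient of the Routhian in the position; the last summand comes from varying G in V x G. *)
Definition routh_force G V : 'cV[R]_3 :=
  - (coef_b J G V *: (J *m rel_velocity (J := J) G V))
  + coef_nu J mu G ^+ 2 *: (J *m G) + (m * g) *: rho
  + (J *m rel_velocity (J := J) G V) *v V.

(* The Euler-Lagrange operator of the Routhian, magnetic term included, along
   a curve with position [G], velocity [V] and acceleration [A]. *)
Definition euler_lagrange G V A : 'cV[R]_3 :=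
  routh_force G V - drouth_momentum G V A - coef_c J mu G *: (G *v V).

Definition torque G V : 'cV[R]_3 :=
  (J *m rel_velocity (J := J) G V) *v rel_velocity (J := J) G V
  + coef_nu J mu G ^+ 2 *: ((J *m G) *v G)
  - (m * g) *: (G *v rho) - coef_c J mu G *: V.

Lemma SigmaE G V :
  Sigma J m g rho mu G V = coef_b J G V *: V + invmx J *m torque G V.
Proof.
rewrite /torque; set w := rel_velocity _ _.
have -> : J *m w = J *m (V *v G) - coef_b J G V *: (J *m G).
  by rewrite mulmxBr -scalemxAr.
by [].
Qed.

(** Only J r x r has a component along G, and G x r = V evaluates it. *)
Lemma dot_torque G V : tangent_sphere2 G V ->
  G *d torque G V = - (V *d (J *m rel_velocity (J := J) G V)).
Proof.
move=> T; have [G1 GV] := T.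
rewrite /torque !dotlin GV dot_crossr dot_crossl !mulr0 addr0 !subr0.
by rewrite dot_cross_rot crossC dotNr cross_rel_velocity// dotC.
Qed.

(** This is G . J r = 0 differentiated, but as an algebraic identity in V and A, with no curve
    involved. *)
Lemma dot_rel_acceleration G V A : sphere2 G ->
  G *d (J *m rel_acceleration G V A) =
  - (V *d (J *m rel_velocity (J := J) G V)).
Proof.
move=> G1; have I0 := lt0r_neq0 (inertia_gt0 J_inertia _ G1).
rewrite /rel_acceleration /rel_velocity /dcoef_b /coef_b.
rewrite !(mulmxDr, mulmxN, opprD) -!scalemxAr !dotlin.
rewrite ![(J *m _) *d _]dotC (inertia_dotC J_inertia (V *v G) V).
rewrite (inertia_dotC J_inertia (V *v G) G) (inertia_dotC J_inertia (A *v G) G).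
rewrite (inertia_dotC J_inertia V G).
by field.
Qed.

Lemma dot_euler_lagrange G V A X : tangent_sphere2 G V -> G *d X = 0 ->
  X *d euler_lagrange G V A =
  X *d (G *v (torque G V - J *m rel_acceleration G V A)).
Proof.
move=> T GX; have [G1 GV] := T.
have Gw := dot_rel_velocity (J := J) _ V G1.
have GJw := dot_inertia_rel_velocity J_inertia _ V G1.
rewrite /euler_lagrange /routh_force /drouth_momentum /torque.
move: Gw GJw; move: (rel_acceleration G V A) (rel_velocity G V) => a w.
move: (J *m w) (J *m a) (J *m G) (coef_b J G V) => Jw Ja JG b Gw GJw.
(* Both J r and V are orthogonal to G, so their cross product is parallel to G. It occurs twice, in
   the force and in the derivative of the momentum, and X sees neither. *)
have par : X *d (Jw *v V) = 0.
  have := cross_parallel G Jw V GJw GV; rewrite G1 scale1r => ->.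
  by rewrite dotZr [X *d G]dotC GX mulr0.
rewrite [V *v Jw]crossC !crossBr !crossDr !crossZr !double_crossr Gw GJw G1.
by rewrite !dotlin [X *d G]dotC GX par; ring.
Qed.

Lemma euler_lagrange_eq0 G V A : tangent_sphere2 G V ->
  (J *m rel_acceleration G V A = torque G V) <->
  (forall X, G *d X = 0 -> X *d euler_lagrange G V A = 0).
Proof.
move=> T; have [G1 _] := T.
split=> [JaT X GX|H].
  by rewrite dot_euler_lagrange// JaT subrr -(scale0r G) crossZr scale0r dotr0.
have GN : G *d (torque G V - J *m rel_acceleration G V A) = 0.
  by rewrite dotBr dot_torque// dot_rel_acceleration// subrr.
set N := torque G V - _ in GN; apply/esym/eqP; rewrite -subr_eq0 -/N; apply/eqP.
(* The test vector X = G x N gives |G x N|^2 = 0; together with G . N = 0 this leaves N = 0. *)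
have GN0 : G *v N = 0.
  apply: dot_eq0; have GGN : G *d (G *v N) = 0 by rewrite dot_crossl.
  by rewrite -[RHS](H _ GGN) dot_euler_lagrange.
have := double_crossr G G N; rewrite GN0 GN G1 scale0r sub0r scale1r.
rewrite crossv0.
by move/esym/eqP; rewrite oppr_eq0 => /eqP.
Qed.

(** Up to multiples of G, r' and A x G differ by b V. From r' to A, the component of A along G is
    supplied by G . A = - |V|^2; from A to r', the unknown multiple of G is removed by pairing J r'
    with G. *)
Lemma reduced_equation_torque G V A : tangent_sphere2 G V ->
  G *d A = - (V *d V) ->
  (A = - (enorm V ^+ 2) *: G + G *v Sigma J m g rho mu G V) <->
  (J *m rel_acceleration G V A = torque G V).
Proof.
move=> T GA; have [G1 GV] := T; rewrite enorm_sqr SigmaE.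
have JJ := inertia_unit J_inertia.
have I0 := lt0r_neq0 (inertia_gt0 J_inertia _ G1).
split=> [AE|JaT].
  (* With the normal part of A gone, A x G = (G x S) x G = S - (G . S) G, which gives the witness
     below. *)
  pose S := coef_b J G V *: V + invmx J *m torque G V.
  have [l al] : exists l : R,
      rel_acceleration G V A = invmx J *m torque G V + l *: G.
    exists (- (G *d S) - dcoef_b G V A).
    rewrite /rel_acceleration {1}AE crossDl crossZl crossvv scaler0 add0r.
    rewrite double_crossl -/S G1 scale1r [S *d G]dotC.
    by rewrite /S; apply: cV3P; rewrite !coordE; ring.
  have := dot_rel_acceleration G V A G1.
  rewrite al mulmxDr mulmxA mulmxV// mul1mx -scalemxAr dotDr dotZr dot_torque//.
  move=> /(canRL (addKr _)); rewrite addNr => /eqP.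
  by rewrite mulf_eq0 (negPf I0) orbF => /eqP ->; rewrite scale0r addr0.
have aE : A *v G = coef_b J G V *: V + invmx J *m torque G V + dcoef_b G V A *: G.
  rewrite -JaT mulmxA mulVmx// mul1mx /rel_acceleration.
  by apply: cV3P; rewrite !coordE; ring.
have := congr1 (cross G) aE; rewrite double_crossr G1 scale1r GA.
rewrite [in RHS]crossDr [G *v (dcoef_b _ _ _ *: _)]crossZr crossvv scaler0 addr0.
by move=> /(canRL (subrK _)) ->; rewrite addrC.
Qed.

End euler_lagrange_algebra.

(** * Functions of class C^2 of two variables *)

Section smooth_functions.
Context {R : realType}.
Implicit Types (U : set (R * R)) (p : R * R).

Lemma continuous_for_comp {A B C : topologicalType} (g : B -> C) (k : A -> B) x :
  {for k x, continuous g} -> {for x, continuous k} ->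
  {for x, continuous (fun y => g (k y))}.
Proof. by move=> cg ck; exact: (cvg_comp _ _ ck cg). Qed.

(** Partials are explicit functions, so that closure under the operations is read off formulas.
    Continuity of f is included since the product rule multiplies partials by f itself. *)
Definition partials {W : normedModType R} U (f f1 f2 : R * R -> W) : Prop :=
  forall p, U p -> [/\ has_derive p ((1, 0) : R * R) f (f1 p),
    has_derive p ((0, 1) : R * R) f (f2 p) & {for p, continuous f}].

Definition isC1 {W : normedModType R} U (f : R * R -> W) : Prop :=
  exists f1 f2, partials U f f1 f2 /\
    forall p, U p -> {for p, continuous f1} /\ {for p, continuous f2}.

Definition isC2 {W : normedModType R} U (f : R * R -> W) : Prop :=
  exists f1 f2, [/\ partials U f f1 f2, isC1 U f1 & isC1 U f2].

Lemma isC1_continuous {W : normedModType R} U (f : R * R -> W) p :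
  isC1 U f -> U p -> {for p, continuous f}.
Proof. by move=> [f1 [f2 [H _]]] /H[]. Qed.

Lemma isC2_C1 {W : normedModType R} U (f : R * R -> W) : isC2 U f -> isC1 U f.
Proof.
move=> [f1 [f2 [H C1 C2]]]; exists f1, f2; split => // p Up.
by split; [exact: (isC1_continuous _ _ _ C1)|exact: (isC1_continuous _ _ _ C2)].
Qed.

Lemma partials_add {W : normedModType R} U (f g f1 f2 g1 g2 : R * R -> W) :
  partials U f f1 f2 -> partials U g g1 g2 ->
  partials U (fun p => f p + g p) (fun p => f1 p + g1 p) (fun p => f2 p + g2 p).
Proof.
move=> pf pg p Up; have [a1 a2 ca] := pf p Up; have [b1 b2 cb] := pg p Up.
by split; [exact: has_derive_addf|exact: has_derive_addf|exact: cvgD].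
Qed.

Lemma isC1_add {W : normedModType R} U (f g : R * R -> W) :
  isC1 U f -> isC1 U g -> isC1 U (fun p => f p + g p).
Proof.
move=> [f1 [f2 [pf cf]]] [g1 [g2 [pg cg]]].
exists (fun p => f1 p + g1 p), (fun p => f2 p + g2 p).
split; first exact: partials_add.
move=> p Up; have [a1 a2] := cf p Up; have [b1 b2] := cg p Up.
by split; exact: cvgD.
Qed.

Lemma isC2_add {W : normedModType R} U (f g : R * R -> W) :
  isC2 U f -> isC2 U g -> isC2 U (fun p => f p + g p).
Proof.
move=> [f1 [f2 [pf cf1 cf2]]] [g1 [g2 [pg cg1 cg2]]].
exists (fun p => f1 p + g1 p), (fun p => f2 p + g2 p).
by split; [exact: partials_add|exact: isC1_add|exact: isC1_add].
Qed.

Lemma partials_mul U (k h k1 k2 h1 h2 : R * R -> R) :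
  partials U k k1 k2 -> partials U h h1 h2 ->
  partials U (fun p => k p * h p) (fun p => k1 p * h p + k p * h1 p)
    (fun p => k2 p * h p + k p * h2 p).
Proof.
move=> pf pg p Up; have [a1 a2 ca] := pf p Up; have [b1 b2 cb] := pg p Up.
by split; [exact: has_derive_mulf|exact: has_derive_mulf|exact: cvgM].
Qed.

Lemma isC1_mul U (k h : R * R -> R) :
  isC1 U k -> isC1 U h -> isC1 U (fun p => k p * h p).
Proof.
move=> [k1 [k2 [pk ck]]] [h1 [h2 [ph ch]]].
exists (fun p => k1 p * h p + k p * h1 p), (fun p => k2 p * h p + k p * h2 p).
split; first exact: partials_mul.
move=> p Up; have [a1 a2] := ck p Up; have [b1 b2] := ch p Up.
have [_ _ a0] := pk p Up; have [_ _ b0] := ph p Up.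
by split; apply: cvgD; exact: cvgM.
Qed.

Lemma isC2_mul U (k h : R * R -> R) :
  isC2 U k -> isC2 U h -> isC2 U (fun p => k p * h p).
Proof.
move=> Ck Ch; have k0 := isC2_C1 _ _ Ck; have h0 := isC2_C1 _ _ Ch.
move: Ck Ch => [k1 [k2 [pk ck1 ck2]]] [h1 [h2 [ph ch1 ch2]]].
exists (fun p => k1 p * h p + k p * h1 p), (fun p => k2 p * h p + k p * h2 p).
by split; [exact: partials_mul|apply: isC1_add; exact: isC1_mul..].
Qed.

Lemma partials_scale U (k k1 k2 : R * R -> R) (f f1 f2 : R * R -> 'cV[R]_3) :
  partials U k k1 k2 -> partials U f f1 f2 ->
  partials U (fun p => k p *: f p) (fun p => k1 p *: f p + k p *: f1 p)
    (fun p => k2 p *: f p + k p *: f2 p).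
Proof.
move=> pf pg p Up; have [a1 a2 ca] := pf p Up; have [b1 b2 cb] := pg p Up.
by split; [exact: has_derive_scalef|exact: has_derive_scalef|exact: cvg_scale].
Qed.

Lemma isC1_scale U (k : R * R -> R) (f : R * R -> 'cV[R]_3) :
  isC1 U k -> isC1 U f -> isC1 U (fun p => k p *: f p).
Proof.
move=> [k1 [k2 [pk ck]]] [f1 [f2 [pf cf]]].
exists (fun p => k1 p *: f p + k p *: f1 p), (fun p => k2 p *: f p + k p *: f2 p).
split; first exact: partials_scale.
move=> p Up; have [a1 a2] := ck p Up; have [b1 b2] := cf p Up.
have [_ _ a0] := pk p Up; have [_ _ b0] := pf p Up.
by split; apply: cvgD; exact: cvg_scale.
Qed.

Lemma isC2_scale U (k : R * R -> R) (f : R * R -> 'cV[R]_3) :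
  isC2 U k -> isC2 U f -> isC2 U (fun p => k p *: f p).
Proof.
move=> Ck Cf; have k0 := isC2_C1 _ _ Ck; have f0 := isC2_C1 _ _ Cf.
move: Ck Cf => [k1 [k2 [pk ck1 ck2]]] [f1 [f2 [pf cf1 cf2]]].
exists (fun p => k1 p *: f p + k p *: f1 p), (fun p => k2 p *: f p + k p *: f2 p).
by split; [exact: partials_scale|apply: isC1_add; exact: isC1_scale..].
Qed.

Lemma partials_comp U (g g' : R -> R) (k k1 k2 : R * R -> R) :
  (forall x, has_derive x (1 : R) g (g' x)) -> partials U k k1 k2 ->
  partials U (fun p => g (k p)) (fun p => g' (k p) * k1 p)
    (fun p => g' (k p) * k2 p).
Proof.
move=> gg' pk [e t] Up; have [a1 a2 ca] := pk _ Up; split.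
- apply/has_derive_fst; apply: has_derive_chain; first exact: gg'.
  exact/has_derive_fst.
- apply/has_derive_snd; apply: has_derive_chain; first exact: gg'.
  exact/has_derive_snd.
- apply: continuous_for_comp ca.
  exact: (has_derive_continuous _ _ _ (gg' _)).
Qed.

Lemma isC1_comp U (g g' : R -> R) (k : R * R -> R) :
  (forall x, has_derive x (1 : R) g (g' x)) -> continuous g' ->
  isC1 U k -> isC1 U (fun p => g (k p)).
Proof.
move=> gg' cg' [k1 [k2 [pk ck]]].
exists (fun p => g' (k p) * k1 p), (fun p => g' (k p) * k2 p).
split; first exact: partials_comp.
move=> p Up; have [a1 a2] := ck p Up; have [_ _ a0] := pk p Up.
have cgk : g' (k q) @[q --> p] --> g' (k p).
  by apply: continuous_for_comp a0; exact: cg'.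
by split; exact: cvgM.
Qed.

Lemma isC2_comp U (g g' g'' : R -> R) (k : R * R -> R) :
  (forall x, has_derive x (1 : R) g (g' x)) ->
  (forall x, has_derive x (1 : R) g' (g'' x)) -> continuous g'' ->
  isC2 U k -> isC2 U (fun p => g (k p)).
Proof.
move=> gg' gg'' cg'' Ck; have k0 := isC2_C1 _ _ Ck.
move: Ck => [k1 [k2 [pk ck1 ck2]]].
exists (fun p => g' (k p) * k1 p), (fun p => g' (k p) * k2 p).
have Cg' : isC1 U (fun p => g' (k p)) by exact: isC1_comp gg'' cg'' k0.
by split; [exact: partials_comp|exact: isC1_mul|exact: isC1_mul].
Qed.

Lemma partials_snd {W : normedModType R} U (g g' : R -> W) :
  (forall p, U p -> has_derive p.2 (1 : R) g (g' p.2)) ->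
  partials U (fun p => g p.2) (fun=> 0) (fun p => g' p.2).
Proof.
move=> gg' [e t] /gg' /= d; split.
- by apply/has_derive_fst => /=; exact: has_derive_const.
- exact/has_derive_snd.
- apply: continuous_for_comp; first exact: (has_derive_continuous _ _ _ d).
  exact: cvg_snd.
Qed.

Lemma isC1_const {W : normedModType R} U (c : W) : isC1 U (fun=> c).
Proof.
exists (fun=> 0), (fun=> 0); split; last by move=> p _; split; exact: cvg_cst.
by move=> p _; split; [exact: has_derive_const|exact: has_derive_const|exact: cvg_cst].
Qed.

Lemma isC1_snd {W : normedModType R} U (g g' : R -> W) :
  (forall p, U p -> has_derive p.2 (1 : R) g (g' p.2)) ->
  (forall p, U p -> {for p.2, continuous g'}) ->
  isC1 U (fun p => g p.2).
Proof.
move=> gg' cg'; exists (fun=> 0), (fun p => g' p.2).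
split; first exact: partials_snd.
move=> p Up; split; first exact: cvg_cst.
apply: continuous_for_comp; first exact: cg'.
exact: cvg_snd.
Qed.

Lemma isC2_snd {W : normedModType R} U (g g' g'' : R -> W) :
  (forall p, U p -> has_derive p.2 (1 : R) g (g' p.2)) ->
  (forall p, U p -> has_derive p.2 (1 : R) g' (g'' p.2)) ->
  (forall p, U p -> {for p.2, continuous g''}) ->
  isC2 U (fun p => g p.2).
Proof.
move=> gg' gg'' cg''; exists (fun=> 0), (fun p => g' p.2).
by split; [exact: partials_snd|exact: isC1_const|exact: isC1_snd gg'' cg''].
Qed.

Lemma isC2_fst U : isC2 U (fun p : R * R => p.1).
Proof.
exists (fun=> 1), (fun=> 0); split; [|exact: isC1_const..].
move=> [e t] _; split.
- by apply/has_derive_fst => /=; exact: has_derive_idr.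
- by apply/has_derive_snd => /=; exact: has_derive_const.
- exact: cvg_fst.
Qed.

Lemma isC2_on U (F : R * R -> 'cV[R]_3) : open U -> isC2 U F -> C2_on U F.
Proof.
move=> oU.
(* Agreement only on U is all that can be asked: the chosen partials match the operator ['D_v] there
   and nowhere else. Openness of U transfers both derivatives and limits. *)
have on1 (f : R * R -> 'cV[R]_3) (g : R * R -> 'cV[R]_3) :
    isC1 U f -> (forall p, U p -> f p = g p) -> C1_on U g.
  move=> [f1 [f2 [pf cf]]] fg p Up.
  have near_fg q : U q -> \forall x \near q, f x = g x.
    move=> Uq; have : \forall x \near q, U x by exact: open_nbhs_nbhs.
    by apply: filterS => x /fg.
  have dg q v d : U q -> has_derive q v f d -> has_derive q v g d.
    move=> Uq /has_deriveP fd; apply/has_deriveP.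
    exact: near_eq_is_derive (near_fg q Uq) fd.
  have Dg i v : (forall q, U q -> has_derive q v f (i q)) ->
      {for p, continuous i} -> {for p, continuous ('D_v g)}.
    move=> fi ci; rewrite /prop_for /continuous_at.
    have [_ ->] := dg p v _ Up (fi p Up).
    apply: cvg_trans ci; apply: near_eq_cvg.
    have : \forall x \near p, U x by exact: open_nbhs_nbhs.
    apply: filterS => q Uq.
    by have [_ ->] := dg q v _ Uq (fi q Uq).
  have [d1 d2 _] := pf p Up; have [c1 c2] := cf p Up.
  split.
  - by have [] := dg _ _ _ Up d1.
  - by have [] := dg _ _ _ Up d2.
  - by apply: (Dg f1) c1 => q /pf[].
  - by apply: (Dg f2) c2 => q /pf[].
move=> CF; have C1F := isC2_C1 _ _ CF.
have [f1 [f2 [pF c1 c2]]] := CF.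
split.
- by apply: on1 C1F _.
- by apply: on1 c1 _ => p /pF[[_ ->]].
- by apply: on1 c2 _ => p /pF[_ [_ ->]].
Qed.

End smooth_functions.

(** * Calculus of the Routhian *)

Section routhian_calculus.
Context {R : realType} {J : 'M[R]_3} (J_inertia : inertia_matrix J).
Context (m g mu : R) (rho : 'cV[R]_3).
Implicit Types (G V A X W : 'cV[R]_3).

(** On the sphere this is the Routhian with b^2 I and nu^2 I over one denominator, so that the
    quotient rule is applied only once. *)
Definition routhian_fraction G V : R :=
  2^-1 * ((V *v G) *d (J *m (V *v G)))
  - 2^-1 * ((((J *m G) *d (V *v G)) * ((J *m G) *d (V *v G)) + mu * mu)
     / (G *d (J *m G))) + (m * g) * (G *d rho).

Lemma routhian_fractionE G V : sphere2 G ->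
  reduced_routhian (J := J) m g mu rho G V = routhian_fraction G V.
Proof.
move=> G1; have I0 := lt0r_neq0 (inertia_gt0 J_inertia _ G1).
by rewrite /reduced_routhian /routhian_fraction /coef_b /coef_nu; field.
Qed.

(* The derivative of the Routhian when the position moves along [X] and the
   velocity along [W]. *)
Definition drouthian G V X W : R :=
  (W *v G + V *v X) *d (J *m rel_velocity (J := J) G V)
  + X *d (- (coef_b J G V *: (J *m rel_velocity (J := J) G V))
          + coef_nu J mu G ^+ 2 *: (J *m G) + (m * g) *: rho).

Lemma has_derive_routhian {E : normedModType R} (p v : E)
    (f k : E -> 'cV[R]_3) df dk :
  has_derive p v f df -> has_derive p v k dk -> f p *d (J *m f p) != 0 ->
  has_derive p v (fun q => routhian_fraction (f q) (k q))
    (drouthian (f p) (k p) df dk).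
Proof.
move=> fd kd I0.
have Jf := has_derive_mull J _ _ _ _ fd.
have Y := has_derive_crossf _ _ _ _ _ _ kd fd.
have JY := has_derive_mull J _ _ _ _ Y.
have I := has_derive_dot _ _ _ _ _ _ fd Jf.
have N := has_derive_dot _ _ _ _ _ _ Jf Y.
have NN := has_derive_addr _ _ _ _ _ _ (has_derive_mulf _ _ _ _ _ _ N N)
  (has_derive_constr (mu * mu) p v).
have NI := has_derive_divf _ _ _ _ _ _ NN I I0.
have YY := has_derive_dot _ _ _ _ _ _ Y JY.
have P := has_derive_dot _ _ _ _ _ _ fd (has_derive_const rho p v).
have D := has_derive_addr _ _ _ _ _ _
  (has_derive_subr _ _ _ _ _ _ (has_derive_mulc 2^-1 _ _ _ _ YY)
     (has_derive_mulc 2^-1 _ _ _ _ NI)) (has_derive_mulc (m * g) _ _ _ _ P).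
apply: has_derive_eq D _; rewrite /drouthian /rel_velocity /coef_b /coef_nu.
move: (f p) (k p) I0 => G V I0.
rewrite dotr0 addr0 !(mulmxDr, mulmxN) -!scalemxAr !dotlin.
rewrite ![(J *m _) *d _]dotC.
rewrite ?(inertia_dotC J_inertia (V *v G) (dk *v G))
  ?(inertia_dotC J_inertia (V *v G) (V *v df))
  ?(inertia_dotC J_inertia (V *v G) G) ?(inertia_dotC J_inertia (V *v G) df)
  ?(inertia_dotC J_inertia (dk *v G) G) ?(inertia_dotC J_inertia (V *v df) G)
  ?(inertia_dotC J_inertia df G) ?(inertia_dotC J_inertia G df).
by field.
Qed.

Lemma has_derive_rel_velocity (G V : R -> 'cV[R]_3) (t : R) A :
  has_derive t (1 : R) G (V t) -> has_derive t (1 : R) V A ->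
  G t *d (J *m G t) != 0 ->
  has_derive t (1 : R) (fun s => rel_velocity (J := J) (G s) (V s))
    (rel_acceleration (J := J) (G t) (V t) A).
Proof.
move=> Gd Vd I0.
have JG := has_derive_mull J _ _ _ _ Gd.
have Y := has_derive_crossf _ _ _ _ _ _ Vd Gd.
have N := has_derive_dot _ _ _ _ _ _ JG Y.
have I := has_derive_dot _ _ _ _ _ _ Gd JG.
have b := has_derive_divf _ _ _ _ _ _ N I I0.
have D := has_derive_subf _ _ _ _ _ _ Y (has_derive_scalef _ _ _ _ _ _ b Gd).
apply: has_derive_eq D _.
by rewrite /rel_acceleration /dcoef_b /coef_b crossvv addr0.
Qed.

Lemma has_derive_routh_momentum (G V : R -> 'cV[R]_3) (t : R) A :
  has_derive t (1 : R) G (V t) -> has_derive t (1 : R) V A ->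
  G t *d (J *m G t) != 0 ->
  has_derive t (1 : R) (fun s => routh_momentum (J := J) (G s) (V s))
    (drouth_momentum (J := J) (G t) (V t) A).
Proof.
move=> Gd Vd I0; have w := has_derive_rel_velocity _ _ _ _ Gd Vd I0.
exact: has_derive_crossf Gd (has_derive_mull J _ _ _ _ w).
Qed.

Section continuity.
Context {T : Type} {F : set_system T} {FF : Filter F}.
Context (f k l n : T -> 'cV[R]_3) (G V A X : 'cV[R]_3).
Hypotheses (fG : f @ F --> G) (kV : k @ F --> V) (lA : l @ F --> A)
  (nX : n @ F --> X) (I0 : G *d (J *m G) != 0).

Lemma cvg_coef_b : coef_b J (f t) (k t) @[t --> F] --> coef_b J G V.
Proof.
apply: cvg_div => //; apply: cvg_dot => //; [exact: cvg_mull|exact: cvg_cross|].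
exact: cvg_mull.
Qed.

Lemma cvg_rel_velocity :
  rel_velocity (J := J) (f t) (k t) @[t --> F] --> rel_velocity (J := J) G V.
Proof.
by apply: cvgB; [exact: cvg_cross|apply: cvg_scale => //; exact: cvg_coef_b].
Qed.

Lemma cvg_coef_nu : coef_nu J mu (f t) @[t --> F] --> coef_nu J mu G.
Proof.
by apply: cvg_div => //; [exact: cvg_cst|apply: cvg_dot => //; exact: cvg_mull].
Qed.

Lemma cvg_coef_c : coef_c J mu (f t) @[t --> F] --> coef_c J mu G.
Proof.
apply: cvgM; first exact: cvg_coef_nu.
apply: cvgB; first exact: cvg_cst.
apply: cvgMr; rewrite enorm_sqr; under eq_fun do rewrite enorm_sqr.
by apply: cvg_div => //; apply: cvg_dot => //; exact: cvg_mull.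
Qed.

Lemma cvg_rel_acceleration :
  rel_acceleration (J := J) (f t) (k t) (l t) @[t --> F] -->
  rel_acceleration (J := J) G V A.
Proof.
apply: cvgB; first exact: cvg_cross.
apply: cvgD; last by apply: cvg_scale => //; exact: cvg_coef_b.
apply: cvg_scale => //.
have Jf := cvg_mull (FF := FF) J _ _ fG; have Jk := cvg_mull (FF := FF) J _ _ kV.
have fJf := cvg_dot (FF := FF) _ _ _ _ fG Jf; have kf := cvg_cross (FF := FF) _ _ _ _ kV fG.
apply: cvg_div; first by rewrite expf_neq0.
  apply: cvgB; apply: cvgM => //.
  - apply: cvgD; apply: cvg_dot => //; exact: cvg_cross.
  - exact: cvg_dot.
  - by apply: cvgD; exact: cvg_dot.
by rewrite expr2; under eq_fun do rewrite expr2; exact: cvgM.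
Qed.

Lemma cvg_drouth_momentum :
  drouth_momentum (J := J) (f t) (k t) (l t) @[t --> F] -->
  drouth_momentum (J := J) G V A.
Proof.
apply: cvgD; apply: cvg_cross => //; apply: cvg_mull.
  exact: cvg_rel_velocity.
exact: cvg_rel_acceleration.
Qed.

Lemma cvg_position_force :
  - (coef_b J (f t) (k t) *: (J *m rel_velocity (J := J) (f t) (k t)))
  + coef_nu J mu (f t) ^+ 2 *: (J *m f t) + (m * g) *: rho @[t --> F] -->
  - (coef_b J G V *: (J *m rel_velocity (J := J) G V))
  + coef_nu J mu G ^+ 2 *: (J *m G) + (m * g) *: rho.
Proof.
apply: cvgD; last exact: cvg_cst.
apply: cvgD.
  apply: cvgN; apply: cvg_scale; first exact: cvg_coef_b.
  by apply: cvg_mull; exact: cvg_rel_velocity.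
apply: cvg_scale; last exact: cvg_mull.
rewrite expr2; under eq_fun do rewrite expr2.
by apply: cvgM; exact: cvg_coef_nu.
Qed.

Lemma cvg_drouthian :
  drouthian (f t) (k t) (l t) (n t) @[t --> F] --> drouthian G V A X.
Proof.
apply: cvgD; apply: cvg_dot => //; last exact: cvg_position_force.
- by apply: cvgD; exact: cvg_cross.
- by apply: cvg_mull; exact: cvg_rel_velocity.
Qed.

Lemma cvg_euler_lagrange :
  euler_lagrange (J := J) m g mu rho (f t) (k t) (l t) @[t --> F] -->
  euler_lagrange (J := J) m g mu rho G V A.
Proof.
apply: cvgB; last first.
  by apply: cvg_scale; [exact: cvg_coef_c|exact: cvg_cross].
apply: cvgB; last exact: cvg_drouth_momentum.
apply: cvgD; first exact: cvg_position_force.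
by apply: cvg_cross => //; apply: cvg_mull; exact: cvg_rel_velocity.
Qed.

Lemma cvg_routhian_fraction :
  routhian_fraction (f t) (k t) @[t --> F] --> routhian_fraction G V.
Proof.
have Jf := cvg_mull (FF := FF) J _ _ fG; have kf := cvg_cross (FF := FF) _ _ _ _ kV fG.
have Jkf := cvg_mull (FF := FF) J _ _ kf; have N := cvg_dot (FF := FF) _ _ _ _ Jf kf.
apply: cvgD; last by apply: cvgMr; apply: cvg_dot => //; exact: cvg_cst.
apply: cvgB; first by apply: cvgMr; exact: cvg_dot.
apply: cvgMr; apply: cvg_div => //; last exact: cvg_dot.
by apply: cvgD; [exact: cvgM|exact: cvg_cst].
Qed.

End continuity.
End routhian_calculus.

(** * Curves on the sphere and their variations *)

Section curves.
Context {R : realType}.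
Implicit Types (G : R -> 'cV[R]_3) (F : R * R -> 'cV[R]_3).

Lemma near_itv (a b t : R) : a < t < b -> \forall s \near t, a < s < b.
Proof.
move=> /andP[at_ tb]; near=> s; apply/andP; split; near: s.
  exact: lt_nbhsr.
exact: lt_nbhsl.
Unshelve. all: by end_near. Qed.

Lemma near_const_derive (f : R -> R) (c t d : R) :
  (\forall s \near t, f s = c) -> has_derive t (1 : R) f d -> d = 0.
Proof.
move=> fc /has_deriveP fd; have fc' : \forall s \near t, f s = cst c s by [].
have [_ <-] := (has_deriveP _ _ _ _).2 (near_eq_is_derive fc' fd).
exact: derive_cst.
Qed.

Lemma sphere_curve_tangent (G : R -> 'cV[R]_3) (t : R) V :
  (\forall s \near t, sphere2 (G s)) -> has_derive t (1 : R) G V ->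
  G t *d V = 0.
Proof.
move=> Gs Gd; have := near_const_derive _ _ _ _ Gs (has_derive_dot _ _ _ _ _ _ Gd Gd).
by rewrite dotC -mulr2n => /eqP; rewrite mulrn_eq0 => /eqP.
Qed.

Lemma C2_sphere_curveP t0 t1 G t : C2_sphere_curve t0 t1 G -> t0 < t < t1 ->
  [/\ tangent_sphere2 (G t) (derive1 G t), has_derive t (1 : R) G (derive1 G t),
      has_derive t (1 : R) (derive1 G) (derive1n 2 G t),
      {for t, continuous (derive1n 2 G)} &
      G t *d derive1n 2 G t = - (derive1 G t *d derive1 G t)].
Proof.
move=> C t01.
have H s : t0 < s < t1 ->
    has_derive s (1 : R) G (derive1 G s) /\ G s *d derive1 G s = 0.
  move=> s01; have Gd : has_derive s (1 : R) G (derive1 G s).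
    by have [_ dG _ _] := C s s01; split; [exact: dG|rewrite derive1E].
  split; [exact: Gd|apply: sphere_curve_tangent Gd];
    by apply: filterS (near_itv _ _ _ s01) => r /C[].
have [G1 _ dV cA] := C t t01; have [Gd GV] := H t t01.
have Vd : has_derive t (1 : R) (derive1 G) (derive1n 2 G t).
  by split; [exact: dV|rewrite -derive1E].
split; [by split|exact: Gd|exact: Vd|exact: cA|].
have near0 : \forall s \near t, G s *d derive1 G s = 0.
  by apply: filterS (near_itv _ _ _ t01) => r /H[].
have := near_const_derive _ _ _ _ near0 (has_derive_dot _ _ _ _ _ _ Gd Vd).
by move=> /eqP; rewrite addrC addr_eq0 => /eqP.
Qed.

Definition strip (d t0 t1 : R) : set (R * R) :=
  [set p : R * R | - d < p.1 < d /\ t0 < p.2 < t1].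

Lemma near_strip d t0 t1 p : strip d t0 t1 p ->
  \forall q \near p, strip d t0 t1 q.
Proof.
case: p => e t [/= ed t01].
have n1 : \forall q \near (e, t), - d < q.1 < d.
  have c1 : q.1 @[q --> (e, t)] --> e by exact: cvg_fst.
  exact: (c1 _ (near_itv _ _ _ ed)).
have n2 : \forall q \near (e, t), t0 < q.2 < t1.
  have c2 : q.2 @[q --> (e, t)] --> t by exact: cvg_snd.
  exact: (c2 _ (near_itv _ _ _ t01)).
exact: filterI.
Qed.

Lemma continuous_C1_on (U : set (R * R)) F p :
  (\forall q \near p, U q) -> C1_on U F -> {for p, continuous F}.
Proof.
case: p => e t nU CF.
have : has_derive (e, t) ((1, 0) : R * R) F ('D_((1, 0) : R * R) F (e, t)).
  by have [] := CF _ (nbhs_singleton nU).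
have [_ /derivable_mxP d2 c1 _] := CF _ (nbhs_singleton nU).
move=> _; apply/cvg_mxP => i j.
apply: (@continuous_of_partials _ (fun q => F q i j)
   (fun q => 'D_((1, 0) : R * R) F q i j)); last exact: d2.
  apply: filterS nU => q /CF[d1 _ _ _].
  by have /has_derive_mxP : has_derive q ((1, 0) : R * R) F
    ('D_((1, 0) : R * R) F q) by [].
exact: ((cvg_mxP _ _).1 c1 i j).
Qed.

Lemma variationP (t0 t1 T d : R) G F (e t : R) : Defs.variation t0 t1 T d G F ->
  - d < e < d -> t0 < t < t1 ->
  let F1 := 'D_((1, 0) : R * R) F in
  let F2 := 'D_((0, 1) : R * R) F in
  let F21 := 'D_((1, 0) : R * R) F2 in
  [/\ has_derive e (1 : R) (fun x => F (x, t)) (F1 (e, t)),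
      has_derive t (1 : R) (fun y => F (e, y)) (F2 (e, t)),
      has_derive e (1 : R) (fun x => F2 (x, t)) (F21 (e, t)),
      [/\ {for (e, t), continuous F}, {for (e, t), continuous F1},
          {for (e, t), continuous F2} & {for (e, t), continuous F21}] &
      tangent_sphere2 (F (e, t)) (F2 (e, t)) /\ F (e, t) *d F1 (e, t) = 0].
Proof.
move=> [[C0 C1 C2] Fs FG _] ed t01 F1 F2 F21.
have Up : strip d t0 t1 (e, t) by [].
have [d1 d2 c1 c2] := C0 _ Up; have [d21 _ c21 _] := C2 _ Up.
have D1 : has_derive e (1 : R) (fun x => F (x, t)) (F1 (e, t)).
  by apply/has_derive_fst; split; [exact: d1|].
have D2 : has_derive t (1 : R) (fun y => F (e, y)) (F2 (e, t)).
  by apply/has_derive_snd; split; [exact: d2|].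
have D21 : has_derive e (1 : R) (fun x => F2 (x, t)) (F21 (e, t)).
  by apply: (has_derive_fst F2 e t _).1; split; [exact: d21|].
split; [exact: D1|exact: D2|exact: D21| |].
- split; [|exact: c1|exact: c2|exact: c21]; apply: continuous_C1_on C0; exact: near_strip.
- split; first split; first exact: Fs.
    apply: sphere_curve_tangent D2.
    by apply: filterS (near_itv _ _ _ t01) => y; exact: Fs.
  apply: (sphere_curve_tangent (fun x => F (x, t)) e) D1.
  by apply: filterS (near_itv _ _ _ ed) => x ?; exact: Fs.
Qed.

End curves.

(** * The first variation of the Routhian action *)

Section first_variation.
Context {R : realType} {J : 'M[R]_3} (J_inertia : inertia_matrix J).
Context (m g mu : R) (rho : 'cV[R]_3).

Let I0 (X : 'cV[R]_3) : sphere2 X -> X *d (J *m X) != 0.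
Proof. by move=> ?; rewrite lt0r_neq0// inertia_gt0. Qed.

Lemma drouthian_momentum (G V X W : 'cV[R]_3) :
  drouthian (J := J) m g mu rho G V X W - (routh_momentum (J := J) G V) *d W =
  X *d routh_force (J := J) m g mu rho G V.
Proof.
rewrite /drouthian /routh_force /routh_momentum.
move: (rel_velocity _ _) (coef_b _ _ _) (coef_nu _ _ _) => w b nu.
by rewrite !coordE; ring.
Qed.

(* Subtracting the derivative of [P . F], whose integral does not depend on
   the variation parameter, from the integrand cancels the term in the
   derivative of the velocity: neither an integration by parts nor the symmetry
   of second derivatives is needed. *)
Lemma first_variation Rmu t0 t1 T d G F :
  is_routhian J m g rho mu Rmu -> t0 < 0 -> 0 < T -> T < t1 ->
  C2_sphere_curve t0 t1 G -> 0 < d -> Defs.variation t0 t1 T d G F ->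
  is_derive (0 : R) (1 : R)
    (fun e : R => \int[lebesgue_measure]_(t in `[0, T])
       Rmu (F (e, t)) ('D_((0, 1) : R * R) F (e, t)))
    (\int[lebesgue_measure]_(t in `[0, T])
       ('D_((1, 0) : R * R) F (0, t) *d
         (routh_force (J := J) m g mu rho (G t) (derive1 G t)
          - drouth_momentum (J := J) (G t) (derive1 G t) (derive1n 2 G t)))).
Proof.
move=> Rmu_routhian t00 T0 Tt1 GC d0 vF.
have in01 t : 0 <= t <= T -> t0 < t < t1 by move=> ?; lra.
pose P t := routh_momentum (J := J) (G t) (derive1 G t).
pose P' t := drouth_momentum (J := J) (G t) (derive1 G t) (derive1n 2 G t).
have PP' t : 0 <= t <= T -> has_derive t (1 : R) P (P' t).
  move=> /in01 t01; have [[G1 _] Gd Vd _ _] := C2_sphere_curveP _ _ _ _ GC t01.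
  by apply: has_derive_routh_momentum; [exact: Gd|exact: Vd|exact: I0].
have cP' t : 0 <= t <= T -> {for t, continuous P'}.
  move=> /in01 t01; have [[G1 _] Gd Vd cA _] := C2_sphere_curveP _ _ _ _ GC t01.
  apply: cvg_drouth_momentum; [|..|exact: I0].
  - exact: (has_derive_continuous _ _ _ Gd).
  - exact: (has_derive_continuous _ _ _ Vd).
  - exact: cA.
set F1 := 'D_((1, 0) : R * R) F; set F2 := 'D_((0, 1) : R * R) F.
pose F21 := 'D_((1, 0) : R * R) F2.
pose l p := routhian_fraction (J := J) m g mu rho (F p) (F2 p).
(* P and P' are taken along the unvaried curve, hence constant in e; the bracket is the time
   derivative of P . F (e, .). *)
pose h p := l p - (P p.2 *d F2 p + P' p.2 *d F p).
pose h1 p := drouthian (J := J) m g mu rho (F p) (F2 p) (F1 p) (F21 p)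
  - (P p.2 *d F21 p + P' p.2 *d F1 p).
have vP e t (ed : - d < e < d) (tT : 0 <= t <= T) :=
  variationP _ _ _ _ _ _ _ _ vF ed (in01 _ tT).
have hh1 e t : - d < e < d -> 0 <= t <= T ->
    has_derive e (1 : R) (fun x => h (x, t)) (h1 (e, t)).
  move=> ed tT; have [D1 D2 D21 _ [[S1 _] _]] := vP e t ed tT.
  have Dl := has_derive_routhian J_inertia m g mu rho _ _ _ _ _ _ D1 D21 (I0 _ S1).
  have DP := has_derive_dot _ _ _ _ _ _ (has_derive_const (P t) e (1 : R)) D21.
  have DP' := has_derive_dot _ _ _ _ _ _ (has_derive_const (P' t) e (1 : R)) D1.
  have D := has_derive_subr _ _ _ _ _ _ Dl (has_derive_addr _ _ _ _ _ _ DP DP').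
  by apply: has_derive_eq D _; rewrite dot0r dot0r !add0r.
have slice (W : topologicalType) (f : R * R -> W) e t :
    {for (e, t), continuous f} -> {for t, continuous (fun y => f (e, y))}.
  move=> cf; apply: (continuous_for_comp f (fun y : R => (e, y))); first exact: cf.
  exact: (cvg_pair (cvg_cst e) cvg_id).
have cP t : 0 <= t <= T -> {for t, continuous P}.
  by move=> /PP' Pd; exact: (has_derive_continuous _ _ _ Pd).
have cl e t : - d < e < d -> 0 <= t <= T -> {for t, continuous (fun y => l (e, y))}.
  move=> ed tT; have [_ _ _ [c c1 c2 c21] [[S1 _] _]] := vP e t ed tT.
  by apply: cvg_routhian_fraction; [exact: slice c|exact: slice c2|exact: I0].
have ck e t : - d < e < d -> 0 <= t <= T ->
    {for t, continuous (fun y => P y *d F2 (e, y) + P' y *d F (e, y))}.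
  move=> ed tT; have [_ _ _ [c c1 c2 c21] _] := vP e t ed tT.
  by apply: cvgD; apply: cvg_dot;
    [exact: cP|exact: slice c2|exact: cP'|exact: slice c].
have ch e t : - d < e < d -> 0 <= t <= T -> {for t, continuous (fun y => h (e, y))}.
  by move=> ed tT; apply: cvgB; [exact: cl|exact: ck].
have ch1 e t : - d < e < d -> 0 <= t <= T -> {for (e, t), continuous h1}.
  move=> ed tT; have [_ _ _ [c c1 c2 c21] [[S1 _] _]] := vP e t ed tT.
  have c2nd (f : R -> 'cV[R]_3) : {for t, continuous f} ->
      {for (e, t), continuous (fun p : R * R => f p.2)}.
    move=> cf; apply: (continuous_for_comp f snd); [exact: cf|exact: cvg_snd].
  apply: cvgB.
    by apply: cvg_drouthian; [exact: c|exact: c2|exact: c1|exact: c21|exact: I0].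
  apply: cvgD; apply: cvg_dot.
  - by apply: c2nd; exact: cP.
  - exact: c21.
  - by apply: c2nd; exact: cP'.
  - exact: c1.
have main := leibniz_rule h h1 d T d0 hh1 ch ch1.
have zero_d : - d < 0 < d by lra.
have h10 : \int[lebesgue_measure]_(t in `[0, T]) h1 (0, t) =
    \int[lebesgue_measure]_(t in `[0, T]) (F1 (0, t) *d
      (routh_force (J := J) m g mu rho (G t) (derive1 G t) - P' t)).
  apply: eq_Rintegral => t; rewrite inE /= in_itv /= => tT.
  have FG s : 0 <= s <= T -> F (0, s) = G s.
    by case: vF => _ _ FG _ /in01; exact: FG.
  have F2G : F2 (0, t) = derive1 G t.
    have [_ D2 _ _ _] := vP 0 t zero_d tT.
    have [_ [_ Gd] _ _ _] := C2_sphere_curveP _ _ _ _ GC (in01 _ tT).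
    case: D2 => _ D2; apply: (etrans (esym D2)); rewrite derive1E.
    apply: near_eq_derive.
    case: vF => _ _ FG' _.
    by apply: filterS (near_itv _ _ _ (in01 _ tT)) => s /FG'.
  rewrite /h1 FG// F2G dotBr -(drouthian_momentum _ _ _ (F21 (0, t))).
  by rewrite [F1 _ *d P' _]dotC opprD addrA.
rewrite -h10.
pose c := P T *d G T - P 0 *d G 0.
have E e : - d < e < d ->
    \int[lebesgue_measure]_(t in `[0, T]) h (e, t) + c =
    \int[lebesgue_measure]_(t in `[0, T]) Rmu (F (e, t)) (F2 (e, t)).
  move=> ed.
  (* The endpoints of F (e, .) are fixed, so the boundary term is the same for every e. *)
  have -> : c = \int[lebesgue_measure]_(t in `[0, T])
      (P t *d F2 (e, t) + P' t *d F (e, t)).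
    rewrite (Rintegral_derivative (fun t => P t *d F (e, t)) _ 0 T T0).
    - by case: vF => _ _ _ /(_ e ed)[-> ->].
    - move=> t tT; have [_ D2 _ _ _] := vP e t ed tT.
      by apply: has_derive_eq (has_derive_dot _ _ _ _ _ _ (PP' t tT) D2) _; rewrite addrC.
    - by move=> t tT; exact: ck.
  rewrite -RintegralD//; first last.
  - by apply: integrable_segment => t; exact: ck.
  - by apply: integrable_segment => t; exact: ch.
  apply: eq_Rintegral => t; rewrite inE /= in_itv /= => tT.
  have [_ _ _ _ [Tg _]] := vP e t ed tT.
  rewrite (routhianE J_inertia _ _ _ _ _ Rmu_routhian _ _ Tg).
  by rewrite routhian_fractionE ?subrK//; case: Tg.
have /has_deriveP : is_derive (0 : R) (1 : R)
    (fun e => \int[lebesgue_measure]_(t in `[0, T]) h (e, t)) _ := main.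
move=> /has_derive_addr/(_ (has_derive_constr c (0 : R) (1 : R))).
rewrite addr0 => /has_deriveP; apply: near_eq_is_derive.
by apply: filterS (near_itv _ _ _ zero_d) => e /E.
Qed.

End first_variation.

(** * Test variations by rotations *)

Section rotation_variation.
Context {R : realType}.
Implicit Types (G : R -> 'cV[R]_3).

(** Rodrigues' formula: for a unit vector eta, the rotation of X about eta by the angle s. *)
Definition rotated (eta X : 'cV[R]_3) (s : R) : 'cV[R]_3 :=
  (eta *d X) *: eta + cos s *: (X - (eta *d X) *: eta) + sin s *: (eta *v X).

Lemma rotated_sphere eta X s : sphere2 eta -> sphere2 X -> sphere2 (rotated eta X s).
Proof.
rewrite /sphere2 => e1 X1; have s1 := cos2Dsin2 s.
have Xe : X *d eta = eta *d X by rewrite dotC.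
have eeX : eta *d (eta *v X) = 0 by rewrite dot_crossl.
have XeX : X *d (eta *v X) = 0 by rewrite dot_crossr.
rewrite /rotated !dotlin ![(eta *v X) *d eta]dotC ![(eta *v X) *d X]dotC.
rewrite dot_cross_cross eeX XeX Xe e1 X1.
transitivity ((eta *d X) ^+ 2 + (cos s ^+ 2 + sin s ^+ 2) * (1 - (eta *d X) ^+ 2)).
  by ring.
by rewrite s1; ring.
Qed.

Lemma rotated0 eta X : rotated eta X 0 = X.
Proof. by rewrite /rotated cos0 sin0 scale1r scale0r addr0 addrC subrK. Qed.

Lemma has_derive_rotated0 eta X (k : R) :
  has_derive (0 : R) (1 : R) (fun e => rotated eta X (e * k)) (k *: (eta *v X)).
Proof.
have S : has_derive (0 : R) (1 : R) (fun e : R => e * k) k.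
  have D := has_derive_mulf _ _ _ _ _ _ (has_derive_idr 0)
    (has_derive_constr k (0 : R) (1 : R)).
  by apply: has_derive_eq D _; rewrite mul1r mulr0 addr0.
have C := has_derive_chain cos (fun e : R => e * k) 0 _ _
  ((has_deriveP _ _ _ _).2 (is_derive_cos _)) S.
have N := has_derive_chain sin (fun e : R => e * k) 0 _ _
  ((has_deriveP _ _ _ _).2 (is_derive_sin _)) S.
have D := has_derive_addf _ _ _ _ _ _
  (has_derive_addf _ _ _ _ _ _ (has_derive_const ((eta *d X) *: eta) (0 : R) (1 : R))
    (has_derive_scalef _ _ _ _ _ _ C
      (has_derive_const (X - (eta *d X) *: eta) (0 : R) (1 : R))))
  (has_derive_scalef _ _ _ _ _ _ N (has_derive_const (eta *v X) (0 : R) (1 : R))).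
apply: has_derive_eq D _.
by rewrite mul0r cos0 sin0 oppr0 mul0r scale0r !scaler0 !addr0 add0r mul1r.
Qed.

Lemma rotated_isC2 (U : set (R * R)) (k k1 k2 : R -> R) G G1 G2 eta :
  (forall p, U p -> has_derive p.2 (1 : R) k (k1 p.2)) ->
  (forall p, U p -> has_derive p.2 (1 : R) k1 (k2 p.2)) ->
  (forall p, U p -> {for p.2, continuous k2}) ->
  (forall p, U p -> has_derive p.2 (1 : R) G (G1 p.2)) ->
  (forall p, U p -> has_derive p.2 (1 : R) G1 (G2 p.2)) ->
  (forall p, U p -> {for p.2, continuous G2}) ->
  isC2 U (fun p => rotated eta (G p.2) (p.1 * k p.2)).
Proof.
move=> kd k1d ck Gd G1d cG.
have lin (A : 'M[R]_3) : isC2 U (fun p : R * R => A *m G p.2).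
  apply: (isC2_snd U (fun t => A *m G t) (fun t => A *m G1 t) (fun t => A *m G2 t)).
  - by move=> p Up; apply: has_derive_mull; exact: Gd.
  - by move=> p Up; apply: has_derive_mull; exact: G1d.
  - by move=> p Up; apply: cvg_mull; exact: cG.
have CS : isC2 U (fun p : R * R => p.1 * k p.2).
  apply: isC2_mul; first exact: isC2_fst.
  exact: (isC2_snd U k k1 k2).
have dsin x : has_derive x (1 : R) sin (cos x).
  by apply/has_deriveP; exact: is_derive_sin.
have dcos x : has_derive x (1 : R) cos (- sin x).
  by apply/has_deriveP; exact: is_derive_cos.
have dNsin x : has_derive x (1 : R) (fun y => - sin y) (- cos x).
  by apply/has_deriveP; apply: is_deriveN.
have cNcos : continuous (fun x : R => - cos x).
  by move=> x; apply: cvgN; exact: continuous_cos.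
have cNsin : continuous (fun x : R => - sin x).
  by move=> x; apply: cvgN; exact: continuous_sin.
have proj X : (eta *m eta^T) *m X = (eta *d X) *: eta.
  apply: cV3P; rewrite !coordE mulcE !mxE !big_ord1 !mxE; ring.
(* Constant matrices act on G, and e enters only through scalar factors; closure under sums and
   scalings then suffices. *)
have E : (fun p : R * R => rotated eta (G p.2) (p.1 * k p.2)) =
    (fun p : R * R => (eta *m eta^T) *m G p.2
       + cos (p.1 * k p.2) *: ((1%:M - eta *m eta^T) *m G p.2)
       + sin (p.1 * k p.2) *: (hat eta *m G p.2)).
  by apply/funext => p; rewrite mulmxBl mul1mx !proj hatE.
rewrite E; apply: isC2_add; first apply: isC2_add; first exact: lin.
- apply: isC2_scale (lin _).
  exact: (isC2_comp U cos (fun x => - sin x) (fun x => - cos x)).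
- apply: isC2_scale (lin _).
  exact: (isC2_comp U sin cos (fun x => - sin x)).
Qed.

Lemma rotation_variation t0 t1 T G eta a b :
  C2_sphere_curve t0 t1 G -> sphere2 eta ->
  0 <= a -> a < b -> b <= T ->
  exists F : R * R -> 'cV[R]_3, Defs.variation t0 t1 T 1 G F /\
    forall t, 'D_((1, 0) : R * R) F (0, t) = cubic_bump a b t *: (eta *v G t).
Proof.
move=> GC eta1 a0 ab bT.
exists (fun p => rotated eta (G p.2) (p.1 * cubic_bump a b p.2)); split; last first.
  move=> t; have [_ DE] : has_derive (0, t) ((1, 0) : R * R)
      (fun p : R * R => rotated eta (G p.2) (p.1 * cubic_bump a b p.2))
      (cubic_bump a b t *: (eta *v G t)).
    apply/has_derive_fst => /=.
    exact: (has_derive_rotated0 eta (G t) (cubic_bump a b t)).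
  exact: DE.
split.
- apply: isC2_on; first by rewrite openE => p /near_strip.
  have inU p : strip 1 t0 t1 p -> t0 < p.2 < t1 by case.
  apply: (rotated_isC2 _ (cubic_bump a b) (cubic_bump1 a b) (cubic_bump2 a b)
    G (derive1 G) (derive1n 2 G)).
  + by move=> p _; exact: has_derive_cubic_bump.
  + by move=> p _; exact: has_derive_cubic_bump1.
  + by move=> p _; exact: cubic_bump2_continuous.
  + by move=> p /inU/(C2_sphere_curveP _ _ _ _ GC)[].
  + by move=> p /inU/(C2_sphere_curveP _ _ _ _ GC)[].
  + by move=> p /inU/(C2_sphere_curveP _ _ _ _ GC)[].
- move=> e t _ /(C2_sphere_curveP _ _ _ _ GC)[[G1 _] _ _ _ _].
  exact: rotated_sphere.
- by move=> t _ /=; rewrite mul0r rotated0.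
(* Since ]a, b[ lies in ]0, T[, the angle is 0 at times 0 and T, also when a = 0 or b = T. *)
- move=> e _ /=; have z t : ~~ (a < t < b) -> cubic_bump a b t = 0.
    by move=> ?; rewrite cubic_bump_eq0// ltW.
  split; rewrite z ?mulr0 ?rotated0//.
    by rewrite negb_and -leNgt a0.
  by rewrite negb_and -!leNgt bT orbT.
Qed.

End rotation_variation.

(** * From the pendulum equations to the torque equation *)

Section pendulum.
Context {R : realType} {J : 'M[R]_3} (J_inertia : inertia_matrix J).
Context (m g mu : R) (rho : 'cV[R]_3).

(** Substituting w = r + nu G and removing J V by [cross_tr] gives J r' = N + 2 nu (J G x r - q V) -
    nu' J G with q = |J G|^2 / I. The bracket is itself a multiple of J G, so J r' and N agree
    modulo J G. *)
Lemma rel_acceleration_torque (G V w dw A : 'cV[R]_3) (dnu : R) :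
  tangent_sphere2 G V ->
  w = rel_velocity (J := J) G V + coef_nu J mu G *: G ->
  J *m dw = (J *m w) *v w + (m * g) *: (rho *v G) ->
  rel_acceleration (J := J) G V A = dw - (dnu *: G + coef_nu J mu G *: V) ->
  J *m rel_acceleration (J := J) G V A = torque (J := J) m g mu rho G V.
Proof.
move=> T wE Jdw aE; have [G1 GV] := T.
have I0 := lt0r_neq0 (inertia_gt0 J_inertia _ G1).
(* J r' and N have the same product with G, and G . J G > 0, so any such l is 0; the derivative of
   nu need not be computed. *)
suff [l al] : exists l : R, J *m rel_acceleration (J := J) G V A =
    torque (J := J) m g mu rho G V + l *: (J *m G).
  have := dot_rel_acceleration J_inertia G V A G1.
  rewrite al dotDr dotZr dot_torque// => /(canRL (addKr _)); rewrite addNr => /eqP.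
  by rewrite mulf_eq0 (negPf I0) orbF => /eqP ->; rewrite scale0r addr0.
have rJ := dot_inertia_rel_velocity J_inertia G V G1.
have Vr := cross_rel_velocity (J := J) _ _ T.
rewrite aE mulmxBr Jdw wE /torque /coef_c.
move: rJ Vr; move: (rel_velocity _ _) (coef_nu _ _ _) => r nu rJ Vr.
rewrite !mulmxDr -!scalemxAr.
have tr_id : G *v (J *m r) + (J *m G) *v r = \tr J *: V - J *m V.
  by rewrite cross_tr J_inertia.1 Vr.
have aa0 : (J *m G) *d (J *m G) != 0.
  apply/eqP => /dot_eq0 JG0; move: I0; rewrite JG0 dotr0; exact/negP/negPn.
pose q := ((J *m G) *d (J *m G)) / (G *d (J *m G)).
(* As V = G x r, the left side is (J G - q G) x r. The choice of q makes J G - q G orthogonal to J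
   G, and r is too, so the product is parallel to J G. *)
have [l ll] : exists l : R, (J *m G) *v r - q *: V = l *: (J *m G).
  have := cross_parallel (J *m G) (J *m G - q *: G) r.
  rewrite dotBr dotZr [(J *m G) *d G]dotC {1}/q divfK// subrr => /(_ erefl).
  rewrite dot_mull J_inertia.1 rJ => /(_ erefl).
  move=> /(congr1 (fun u => ((J *m G) *d (J *m G))^-1 *: u)).
  rewrite !scalerA mulVf// scale1r crossBl crossZl Vr => ->.
  by eexists.
exists (2 * nu * l - dnu); rewrite enorm_sqr -/q.
have JV : J *m V = \tr J *: V - (G *v (J *m r) + (J *m G) *v r).
  by rewrite tr_id opprB addrC subrK.
rewrite JV scalerBl -(scalerA (2 * nu) l) -ll.
move: (J *m G) (J *m r) (\tr J) @q {ll} => a s tau q.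
by apply: cV3P; rewrite !coordE; ring.
Qed.

Lemma pendulum_curve t0 t1 Q w :
  pendulum_motion J m g rho t0 t1 Q w ->
  (forall t : R, t0 < t < t1 -> momentum J (Q t) (w t) = mu) ->
  let G t := Pi (Q t) in
  C2_sphere_curve t0 t1 G /\
  forall t, t0 < t < t1 ->
    J *m rel_acceleration (J := J) (G t) (derive1 G t) (derive1n 2 G t) =
    torque (J := J) m g mu rho (G t) (derive1 G t).
Proof.
move=> QM Qmu G.
have JJ := inertia_unit J_inertia.
(* Solving the equation for the derivative of w expresses it through w and G; its continuity, and
   with it the class C^2 of G, follows. *)
pose a t := invmx J *m ((J *m w t) *v w t + (m * g) *: (rho *v G t)).
have w'E t : t0 < t < t1 -> has_derive t (1 : R) w (a t).
  move=> /QM[_ _ dw Ew]; split; first exact: dw.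
  by rewrite -derive1E /a -Ew mulmxA mulVmx// mul1mx.
have G1 t : t0 < t < t1 -> sphere2 (G t) by move=> /QM[/Pi_sphere].
have Gd t : t0 < t < t1 -> has_derive t (1 : R) G (G t *v w t).
  move=> /QM[_ /has_deriveP/has_derive_Pi dQ _ _].
  by apply: has_derive_eq dQ _; exact: dPiE.
have VE t : t0 < t < t1 -> derive1 G t = G t *v w t.
  by move=> /Gd[_ <-]; rewrite derive1E.
pose A t := (G t *v w t) *v w t + G t *v a t.
have Vd t : t0 < t < t1 -> has_derive t (1 : R) (derive1 G) (A t).
  move=> t01; have /has_deriveP := has_derive_crossf _ _ _ _ _ _ (Gd t t01) (w'E t t01).
  move=> D; apply/has_deriveP; apply: near_eq_is_derive D.
  by apply: filterS (near_itv _ _ _ t01) => s /VE.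
have AE t : t0 < t < t1 -> derive1n 2 G t = A t.
  by move=> /Vd[_ <-]; rewrite -derive1E.
have cG t : t0 < t < t1 -> {for t, continuous G}.
  by move=> t01; exact: (has_derive_continuous _ _ _ (Gd t t01)).
have cw t : t0 < t < t1 -> {for t, continuous w}.
  by move=> t01; exact: (has_derive_continuous _ _ _ (w'E t t01)).
have cA t : t0 < t < t1 -> {for t, continuous A}.
  move=> t01; have cg := cG t t01; have cwt := cw t t01.
  apply: cvgD; apply: cvg_cross; [exact: cvg_cross|exact: cwt|exact: cg|].
  apply: cvg_mull; apply: cvgD.
    by apply: cvg_cross; [exact: cvg_mull|exact: cwt].
  by apply: cvg_scale; [exact: cvg_cst|apply: cvg_cross; [exact: cvg_cst|exact: cg]].
split.
  move=> t t01; split.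
  - exact: G1.
  - by have [] := Gd t t01.
  - by have [] := Vd t t01.
  - rewrite /prop_for /continuous_at AE//; apply: cvg_trans (cA t t01).
    apply: near_eq_cvg.
    by apply: filterS (near_itv _ _ _ t01) => s /AE.
move=> t t01; have I0 s : t0 < s < t1 -> G s *d (J *m G s) != 0.
  by move=> /G1 ?; rewrite lt0r_neq0// inertia_gt0.
have Gd' : has_derive t (1 : R) G (derive1 G t).
  by apply: has_derive_eq (Gd t t01) _; rewrite VE.
have Vd' : has_derive t (1 : R) (derive1 G) (derive1n 2 G t).
  by apply: has_derive_eq (Vd t t01) _; rewrite AE.
have wE s : t0 < s < t1 ->
    w s = rel_velocity (J := J) (G s) (derive1 G s) + coef_nu J mu (G s) *: G s.
  move=> s01; have [SQ _ _ _] := QM s s01; rewrite VE// -dPiE.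
  exact: angular_velocityE (Qmu s s01).
have [dnu nud] : exists dnu, has_derive t (1 : R) (fun s => coef_nu J mu (G s)) dnu.
  eexists; apply: has_derive_divf; last exact: I0.
    exact: has_derive_constr.
  by apply: has_derive_dot; [exact: Gd'|apply: has_derive_mull; exact: Gd'].
have D := has_derive_subf _ _ _ _ _ _ (w'E t t01) (has_derive_scalef _ _ _ _ _ _ nud Gd').
have /has_deriveP D' := has_derive_rel_velocity _ _ _ _ Gd' Vd' (I0 t t01).
(* Near t, r coincides with w - nu G, so uniqueness of derivatives equates [rel_acceleration] with
   the value in [D]. *)
have /has_deriveP[_ aE] : is_derive t (1 : R)
    (fun s => w s - coef_nu J mu (G s) *: G s)
    (rel_acceleration (J := J) (G t) (derive1 G t) (derive1n 2 G t)).
  apply: near_eq_is_derive D'.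
  by apply: filterS (near_itv _ _ _ t01) => s /wE ->; rewrite addrK.
apply: (rel_acceleration_torque _ _ (w t) (a t) _ dnu).
- split; first exact: G1.
  by rewrite VE// dot_crossl.
- exact: wE.
- by rewrite mulmxA mulmxV// mul1mx.
- by case: D => _; rewrite aE => ->.
Qed.

End pendulum.

(** * The reduced dynamics *)

Section motions.
Context {R : realType} {J : 'M[R]_3} (J_inertia : inertia_matrix J).
Context (m g mu : R) (rho : 'cV[R]_3).

Lemma magnetic_form_tangent beta (G V X : 'cV[R]_3) :
  is_magnetic_form J mu beta -> tangent_sphere2 G V -> G *d X = 0 ->
  beta G V X = X *d (coef_c J mu G *: (G *v V)).
Proof.
move=> betaP TV GX; have [G1 _] := TV.
have TX : tangent_sphere2 G X by split.
rewrite -(tangent_crossK _ _ TV) -{1}(tangent_crossK _ _ TX).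
rewrite (magnetic_formE J_inertia mu _ betaP)// tangent_crossK//.
rewrite -(cross_cross_sphere _ _ _ G1) !tangent_crossK// dotZr.
by congr (_ * _); rewrite dot_cross_rot dot_cross_rot.
Qed.

Lemma euler_lagrange_variation (G : R -> 'cV[R]_3) F t0 t1 T d beta (t : R) :
  is_magnetic_form J mu beta -> C2_sphere_curve t0 t1 G ->
  Defs.variation t0 t1 T d G F -> 0 < d -> t0 < t < t1 ->
  let X := 'D_((1, 0) : R * R) F (0, t) in
  G t *d X = 0 /\
  X *d (routh_force (J := J) m g mu rho (G t) (derive1 G t)
        - drouth_momentum (J := J) (G t) (derive1 G t) (derive1n 2 G t)) =
  X *d euler_lagrange (J := J) m g mu rho (G t) (derive1 G t) (derive1n 2 G t)
  + beta (G t) (derive1 G t) X.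
Proof.
move=> betaP GC vF d0 t01 X.
have zd : - d < 0 < d by lra.
have [_ _ _ _ [_ FX]] := variationP _ _ _ _ _ _ _ _ vF zd t01.
have FG : F (0, t) = G t by case: vF => _ _ + _; exact.
rewrite FG in FX; split; first exact: FX.
have [TV _ _ _ _] := C2_sphere_curveP _ _ _ _ GC t01.
by rewrite (magnetic_form_tangent _ _ _ _ betaP TV FX) -dotDr subrK.
Qed.

Lemma torque_magnetic_euler_lagrange Rmu beta t0 t1 T (G : R -> 'cV[R]_3) :
  is_routhian J m g rho mu Rmu -> is_magnetic_form J mu beta ->
  t0 < 0 -> 0 < T -> T < t1 -> C2_sphere_curve t0 t1 G ->
  (forall t, 0 <= t <= T ->
    J *m rel_acceleration (J := J) (G t) (derive1 G t) (derive1n 2 G t) =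
    torque (J := J) m g mu rho (G t) (derive1 G t)) ->
  magnetic_euler_lagrange Rmu beta t0 t1 T G.
Proof.
move=> RP betaP t00 T0 Tt1 GC tq d F d0 vF.
have FV := first_variation J_inertia m g mu rho _ _ _ _ _ _ _ RP t00 T0 Tt1 GC d0 vF.
apply: is_derive_eq FV _.
apply: eq_Rintegral => t; rewrite inE /= in_itv /= => tT.
have t01 : t0 < t < t1 by lra.
have [TV _ _ _ _] := C2_sphere_curveP _ _ _ _ GC t01.
have [FX ->] := euler_lagrange_variation _ _ _ _ _ _ _ _ betaP GC vF d0 t01.
have [H _] := euler_lagrange_eq0 J_inertia m g mu rho _ _ (derive1n 2 G t) TV.
by rewrite (H (tq t tT))// add0r.
Qed.

Lemma torque_reduced_equation t0 t1 T (G : R -> 'cV[R]_3) :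
  t0 < 0 -> T < t1 -> C2_sphere_curve t0 t1 G ->
  (forall t, 0 <= t <= T ->
    J *m rel_acceleration (J := J) (G t) (derive1 G t) (derive1n 2 G t) =
    torque (J := J) m g mu rho (G t) (derive1 G t)) ->
  reduced_equation J m g rho mu T G.
Proof.
move=> t00 Tt1 GC tq t tT; have t01 : t0 < t < t1 by lra.
have [TV _ _ _ GA] := C2_sphere_curveP _ _ _ _ GC t01.
exact: (reduced_equation_torque J_inertia m g mu rho _ _ _ TV GA).2 (tq t tT).
Qed.

Lemma magnetic_euler_lagrange_torque Rmu beta t0 t1 T (G : R -> 'cV[R]_3) :
  is_routhian J m g rho mu Rmu -> is_magnetic_form J mu beta ->
  t0 < 0 -> 0 < T -> T < t1 -> C2_sphere_curve t0 t1 G ->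
  magnetic_euler_lagrange Rmu beta t0 t1 T G ->
  forall t, 0 <= t <= T ->
    J *m rel_acceleration (J := J) (G t) (derive1 G t) (derive1n 2 G t) =
    torque (J := J) m g mu rho (G t) (derive1 G t).
Proof.
move=> RP betaP t00 T0 Tt1 GC EL.
pose E t := euler_lagrange (J := J) m g mu rho (G t) (derive1 G t) (derive1n 2 G t).
have in01 t : 0 <= t <= T -> t0 < t < t1 by move=> ?; lra.
have cont t : t0 < t < t1 -> [/\ {for t, continuous G},
    {for t, continuous (derive1 G)} & {for t, continuous (derive1n 2 G)}].
  move=> /(C2_sphere_curveP _ _ _ _ GC)[_ Gd Vd cA _]; split.
  - exact: (has_derive_continuous _ _ _ Gd).
  - exact: (has_derive_continuous _ _ _ Vd).
  - exact: cA.
have cE t : 0 <= t <= T -> {for t, continuous E}.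
  move=> /in01 t01; have [cG cV cA] := cont t t01.
  have [[G1 _] _ _ _ _] := C2_sphere_curveP _ _ _ _ GC t01.
  by apply: cvg_euler_lagrange => //; rewrite lt0r_neq0// inertia_gt0.
(* The rotation about eta by e times a bump phi has variation field X = phi (eta x G), and X . E =
   phi (eta . (G x E)): the fundamental lemma applies to the second factor. *)
have GE eta : sphere2 eta -> forall t, 0 <= t <= T -> eta *d (G t *v E t) = 0.
  move=> eta1; apply: (fundamental_lemma _ _ T0) => [t tT|a b a0 ab bT].
    have [cG _ _] := cont t (in01 _ tT).
    by apply: cvg_dot; [exact: cvg_cst|apply: cvg_cross; [exact: cG|exact: cE]].
  have [F [vF DF]] := rotation_variation _ _ _ _ _ _ _ GC eta1 a0 ab bT.
  have [_ D1] := (has_deriveP _ _ _ _).2 (first_variation J_inertia m g mu rho _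
    _ _ _ _ _ _ RP t00 T0 Tt1 GC ltr01 vF).
  have [_ D2] := (has_deriveP _ _ _ _).2 (EL _ _ ltr01 vF).
  (* The computed first variation and the assumed magnetic term are derivatives at 0 of the same
     function, hence equal. *)
  have DD := etrans (esym D1) D2.
  pose k t := (cubic_bump a b t *: (eta *v G t))
    *d (coef_c J mu (G t) *: (G t *v derive1 G t)).
  pose h t := cubic_bump a b t * (eta *d (G t *v E t)).
  have XE t : 0 <= t <= T ->
      let X := 'D_((1, 0) : R * R) F (0, t) in
      beta (G t) (derive1 G t) X = k t /\
      X *d (routh_force (J := J) m g mu rho (G t) (derive1 G t)
        - drouth_momentum (J := J) (G t) (derive1 G t) (derive1n 2 G t)) = h t + k t.
    move=> /in01 t01 X; have [TV _ _ _ _] := C2_sphere_curveP _ _ _ _ GC t01.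
    have [GX ->] := euler_lagrange_variation _ _ _ _ _ _ _ _ betaP GC vF ltr01 t01.
    rewrite (magnetic_form_tangent _ _ _ _ betaP TV GX) DF; split => //.
    congr (_ + _); rewrite dotZl /h -/(E t); congr (_ * _).
    by rewrite dotC dot_cross_rot dot_cross_rot dot_cross_rot dot_cross_rot.
  have bT' t : {for t, continuous (cubic_bump a b)}.
    exact: (has_derive_continuous _ _ _ (has_derive_cubic_bump a b t)).
  have intk : lebesgue_measure.-integrable (`[0, T]%classic : set R) (EFin \o k).
    apply: integrable_segment => t /in01 t01; have [cG cV _] := cont t t01.
    have [[G1 _] _ _ _ _] := C2_sphere_curveP _ _ _ _ GC t01.
    apply: cvg_dot; apply: cvg_scale.
    - exact: bT'.
    - by apply: cvg_cross; [exact: cvg_cst|exact: cG].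
    - by apply: cvg_coef_c => //; rewrite lt0r_neq0// inertia_gt0.
    - exact: cvg_cross.
  have inth : lebesgue_measure.-integrable (`[0, T]%classic : set R) (EFin \o h).
    apply: integrable_segment => t tT; have [cG _ _] := cont t (in01 _ tT).
    apply: cvgM; first exact: bT'.
    by apply: cvg_dot; [exact: cvg_cst|apply: cvg_cross; [exact: cG|exact: cE]].
  have I1 : \int[lebesgue_measure]_(t in `[0, T]) (h t + k t) =
      \int[lebesgue_measure]_(t in `[0, T]) k t.
    apply: etrans (etrans DD _).
      by apply: eq_Rintegral => t; rewrite inE /= in_itv /= => /XE[_ ->].
    by apply: eq_Rintegral => t; rewrite inE /= in_itv /= => /XE[-> _].
  by move: I1; rewrite RintegralD// => /(canRL (addrK _)); rewrite subrr.
move=> t tT; have t01 := in01 _ tT.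
have [TV _ _ _ _] := C2_sphere_curveP _ _ _ _ GC t01.
(* The three coordinate axes as eta give all components. *)
have GE0 : G t *v E t = 0.
  have deltaE (v : 'cV[R]_3) i : delta_mx i 0 *d v = v i 0.
    by rewrite dotE !mxE; move: i; apply: ord3_ind => /=; ring.
  have c i : (G t *v E t) i 0 = 0.
    by rewrite -deltaE; apply: GE; rewrite // /sphere2 deltaE mxE !eqxx.
  by apply: cV3P; rewrite c zerocE.
apply/(euler_lagrange_eq0 J_inertia m g mu rho _ _ _ TV) => X GX.
have [G1 _] := TV.
have TX : tangent_sphere2 (G t) X by split.
rewrite -(tangent_crossK _ _ TX) -/(E t); move: (X *v G t) => u.
by rewrite dotC 2!dot_cross_rot [E t *v _]crossC GE0 oppr0 dotr0.
Qed.

End motions.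
Theorem proposition16 (R : realType) (J : 'M[R]_3) (m g : R)
    (rho : 'cV[R]_3) (mu : R)
    (J_inertia : inertia_matrix J) (m_gt0 : 0 < m) (g_gt0 : 0 < g)
    (rho_neq0 : rho != 0) :
  (exists Rmu : 'cV[R]_3 -> 'cV[R]_3 -> R, is_routhian J m g rho mu Rmu) /\
  (exists beta : 'cV[R]_3 -> 'cV[R]_3 -> 'cV[R]_3 -> R,
     is_magnetic_form J mu beta) /\
  forall (Rmu : 'cV[R]_3 -> 'cV[R]_3 -> R)
         (beta : 'cV[R]_3 -> 'cV[R]_3 -> 'cV[R]_3 -> R),
    is_routhian J m g rho mu Rmu ->
    is_magnetic_form J mu beta ->
    [/\ forall G V : 'cV[R]_3, tangent_sphere2 G V ->
          Rmu G V =
          2^-1 * ((V *v G) *d (J *m (V *v G)))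
          - 2^-1 * (coef_b J G V ^+ 2 + coef_nu J mu G ^+ 2)
                 * (G *d (J *m G))
          + m * g * (G *d rho),
        forall G eta zeta : 'cV[R]_3, sphere2 G ->
          beta G (G *v eta) (G *v zeta) =
          - (mu / (G *d (J *m G)) ^+ 2)
          * (- (G *d (J *m G)) * \tr J + 2 * enorm (J *m G) ^+ 2)
          * (G *d (eta *v zeta)),
        forall (t0 t1 T : R) (Q : R -> 'M[R]_3) (w : R -> 'cV[R]_3),
          t0 < 0 -> 0 < T -> T < t1 ->
          pendulum_motion J m g rho t0 t1 Q w ->
          (forall t : R, t0 < t < t1 -> momentum J (Q t) (w t) = mu) ->
          [/\ C2_sphere_curve t0 t1 (fun t => Pi (Q t)),
              magnetic_euler_lagrange Rmu beta t0 t1 T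
                (fun t => Pi (Q t)) &
              reduced_equation J m g rho mu T (fun t => Pi (Q t))] &
        forall (t0 t1 T : R) (G : R -> 'cV[R]_3),
          t0 < 0 -> 0 < T -> T < t1 ->
          C2_sphere_curve t0 t1 G ->
          magnetic_euler_lagrange Rmu beta t0 t1 T G ->
          reduced_equation J m g rho mu T G].
Proof.
split.
  exists (reduced_routhian (J := J) m g mu rho) => Q w SQ wmu.
  exact: reduced_routhianP.
split; first by exists (magnetic_form (J := J) mu); exact: magnetic_formP.
move=> Rmu beta RP betaP; split.
- exact: (routhianE J_inertia).
- move=> G eta zeta G1; rewrite (magnetic_formE J_inertia _ _ betaP)//.
  have I0 := lt0r_neq0 (inertia_gt0 J_inertia _ G1).
  by rewrite /coef_c /coef_nu; field.
- move=> t0 t1 T Q w t00 T0 Tt1 QM Qmu.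
  have [GC tq] := pendulum_curve J_inertia _ _ _ _ _ _ _ _ QM Qmu.
  have tqT t (tT : 0 <= t <= T) := tq t (ltac:(lra) : t0 < t < t1).
  split; first exact: GC.
  + exact: (torque_magnetic_euler_lagrange J_inertia m g mu rho).
  + exact: (torque_reduced_equation J_inertia _ _ _ _ t0 t1).
- move=> t0 t1 T G t00 T0 Tt1 GC EL.
  apply: (torque_reduced_equation J_inertia _ _ _ _ t0 t1) => //.
  exact: (magnetic_euler_lagrange_torque J_inertia _ _ _ _ _ _ _ _ _ _
    RP betaP t00 T0 Tt1 GC EL).
Qed.
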